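(* Let $\alpha\in(0,1]$, let $\mathcal{L}$ be the jump uncertainty set in the context, and let $\{Z_i\}$ be an i.i.d. sequence of $\mathbb{R}^d$-valued random variables on a sublinear expectation space $(\Omega,\mathcal{H},\hat{\mathbb{E}})$ with $\hat{\mathbb{E}}[|Z_i|]=\infty$ and $S_n=\sum_{i=1}^nZ_i$, satisfying: (A1) there is $0<\delta<\alpha$ with $M_\delta:=\sup_n\hat{\mathbb{E}}[|n^{-1/\alpha}S_n|^\delta]<\infty$; (A2) there is a function $l$ on $[0,1]$ with $l(s)\to0$ as $s\to0$ such that for each $\varphi\in C_b^3(\mathbb{R}^d)$, $\frac1s\big|\hat{\mathbb{E}}[\varphi(x+s^{1/\alpha}Z_1)-\varphi(x)]-s\sup_{F_\mu\in\mathcal{L}}\int\delta^\alpha_\lambda\varphi(x)F_\mu(d\lambda)\big|\le l(s)$ for all $x\in\mathbb{R}^d$. Then for $\varphi\in C_b^3(\mathbb{R}^d)$ and $s\in[0,1]$, $$\lim_{n\to\infty}\Big|\hat{\mathbb{E}}\big[\varphi(x+(s/n)^{1/\alpha}S_n)\big]-\varphi(x)-s\sup_{F_\mu\in\mathcal{L}}\int_{\mathbb{R}^d}\delta^\alpha_\lambda\varphi(x)F_\mu(d\lambda)\Big|=o(s)$$ uniformly in $x\in\mathbb{R}^d$, where $o(s)/s\to0$ as $s\to0$.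
   Context: Sublinear expectation space: $\hat{\mathbb{E}}$ monotone, constant preserving, sub-additive, positively homogeneous on a space $\mathcal{H}$ closed under composition with bounded Lipschitz functions; random variables need only have $\varphi(X)\in\mathcal{H}$ for bounded Lipschitz $\varphi$. I.i.d.: $Z_{i+1}\overset{d}{=}Z_i$ and $Z_{i+1}$ independent from $(Z_1,\dots,Z_i)$, with independence meaning $\hat{\mathbb{E}}[\varphi(X,Y)]=\hat{\mathbb{E}}[\hat{\mathbb{E}}[\varphi(x,Y)]_{x=X}]$. $F_\mu(B)=\int_S\mu(dz)\int_0^\infty\mathbb{1}_B(rz)r^{-1-\alpha}dr$ for a symmetric finite measure $\mu$ on the unit sphere $S$, and $\mathcal{L}=\{F_\mu:\mu(S)\in(\underline{\Lambda},\overline{\Lambda})\}$ for given $\underline{\Lambda},\overline{\Lambda}>0$. $\delta^\alpha_\lambda\varphi(x)=\varphi(x+\lambda)-\varphi(x)-\langle D\varphi(x),\lambda\mathbb{1}_{\{|\lambda|\le1\}}\rangle$ if $\alpha=1$, $=\varphi(x+\lambda)-\varphi(x)$ if $\alpha\in(0,1)$. $C_b^3$: uniformly bounded derivatives up to order 3. *)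

(* Defs.v *)
From HB Require Import structures.
From mathcomp Require Import all_boot all_order all_algebra.
From mathcomp Require Import all_classical all_reals all_analysis.
Set Implicit Arguments. Unset Strict Implicit. Unset Printing Implicit Defensive.
Import Order.TTheory GRing.Theory Num.Theory.
Import numFieldNormedType.Exports.
Local Open Scope classical_set_scope.
Local Open Scope ring_scope.

Section Defs.
Variable R : realType.

Definition eucl (d : nat) (x : 'rV[R]_d) : R :=
  Num.sqrt (\sum_(i < d) x ord0 i ^+ 2).

(** Bounded Lipschitz functions on a (finite-dimensional) matrix space
    (Lipschitz w.r.t. the library norm; all norms are equivalent here). *)
Definition bLip (m n : nat) (phi : 'M[R]_(m, n) -> R) : Prop :=
  (exists M : R, forall x, `|phi x| <= M) /\
  (exists L : R, forall x y, `|phi x - phi y| <= L * `|x - y|).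

(** Sublinear expectation space (Omega, H, E).  E is given as a total map,
    its axioms are only required on H. *)
Definition sublinear_expectation (Omega : Type)
    (H : set (Omega -> R)) (E : (Omega -> R) -> R) : Prop :=
  [/\ (forall c : R, H (fun _ => c)),
      (forall X Y, H X -> H Y -> H (X \+ Y)),
      (forall (c : R) X, H X -> H (fun w => c * X w)),
      (forall (m n : nat) (X : Omega -> 'M[R]_(m, n)),
          (forall i j, H (fun w => X w i j)) ->
          forall phi, bLip phi -> H (phi \o X))
    & [/\ (forall X Y, H X -> H Y -> (forall w, X w <= Y w) -> E X <= E Y),
          (forall c : R, E (fun _ => c) = c),
          (forall X Y, H X -> H Y -> E (X \+ Y) <= E X + E Y)
        & (forall (lam : R) X, H X -> 0 <= lam ->
              E (fun w => lam * X w) = lam * E X)]].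

Definition rand_mx (Omega : Type) (H : set (Omega -> R)) (m n : nat)
    (X : Omega -> 'M[R]_(m, n)) : Prop :=
  forall phi, bLip phi -> H (phi \o X).

Definition indep (Omega : Type) (E : (Omega -> R) -> R) (m d : nat)
    (X : Omega -> 'M[R]_(m, d)) (Y : Omega -> 'rV[R]_d) : Prop :=
  forall phi : 'M[R]_(m + 1, d) -> R, bLip phi ->
    E (fun w => phi (col_mx (X w) (Y w))) =
    E (fun w => E (fun w' => phi (col_mx (X w) (Y w')))).

Definition ident_distr (Omega : Type) (E : (Omega -> R) -> R) (d : nat)
    (X Y : Omega -> 'rV[R]_d) : Prop :=
  forall phi : 'rV[R]_d -> R, bLip phi -> E (phi \o X) = E (phi \o Y).

(** First i variables Z_1,...,Z_i (here Z 0, ..., Z (i-1)) as an i x d matrix. *)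
Definition first_rows (Omega : Type) (d : nat) (Z : nat -> Omega -> 'rV[R]_d)
    (i : nat) : Omega -> 'M[R]_(i, d) :=
  fun w => \matrix_(j < i, k < d) Z j w ord0 k.

(** i.i.d. sequence (Z 0 = Z_1, Z 1 = Z_2, ...). *)
Definition iid (Omega : Type) (H : set (Omega -> R)) (E : (Omega -> R) -> R)
    (d : nat) (Z : nat -> Omega -> 'rV[R]_d) : Prop :=
  (forall i, rand_mx H (first_rows Z i)) /\
  (forall i, rand_mx H (Z i)) /\
  (forall i, ident_distr E (Z i.+1) (Z i)) /\
  (forall i, indep E (first_rows Z i.+1) (Z i.+1)).

(** Extension of E to nonnegative functions f(X) (f possibly unbounded):
    sup of E[psi(X)] over bounded Lipschitz 0 <= psi <= f. *)
Definition Eup (Omega : Type) (E : (Omega -> R) -> R) (d : nat)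
    (X : Omega -> 'rV[R]_d) (f : 'rV[R]_d -> R) : \bar R :=
  ereal_sup [set (E (psi \o X))%:E | psi in
     [set psi : 'rV[R]_d -> R | bLip psi /\ forall x, 0 <= psi x <= f x]].

Definition partial (d : nat) (f : 'rV[R]_d -> R) (i : 'I_d) : 'rV[R]_d -> R :=
  fun x => 'D_(delta_mx ord0 i) f x.

Definition iter_partial (d : nat) (f : 'rV[R]_d -> R) (s : seq 'I_d) :=
  foldr (fun i g => partial g i) f s.

Definition Cb3 (d : nat) (f : 'rV[R]_d -> R) : Prop :=
  forall s : seq 'I_d, (size s <= 3)%N ->
    [/\ (size s < 3)%N -> forall i x, derivable (iter_partial f s) x (delta_mx ord0 i),
        continuous (iter_partial f s)
      & exists M : R, forall x, `|iter_partial f s x| <= M].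

Definition jump_delta (alpha : R) (d : nat) (phi : 'rV[R]_d -> R)
    (x lam : 'rV[R]_d) : R :=
  if alpha == 1 then
    phi (x + lam) - phi x - (if eucl lam <= 1 then 'D_lam phi x else 0)
  else phi (x + lam) - phi x.

Definition RdB (d : nat) := g_sigma_algebraType (@open 'rV[R]_d).

Definition sphere (d : nat) : set (RdB d) := [set z : 'rV[R]_d | eucl z = 1].

Definition admissible (d : nat) (Llo Lhi : R)
    (mu : {measure set (RdB d) -> \bar R}) : Prop :=
  [/\ mu (~` @sphere d) = 0%E,
      (forall A : set (RdB d), measurable A ->
          mu [set z : RdB d | A (- (z : 'rV[R]_d))] = mu A)
    & (Llo%:E < mu setT < Lhi%:E)%E].

(** int g dF_mu, with F_mu(B) = int_S mu(dz) int_0^oo 1_B(r z) r^{-1-alpha} dr. *)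
Definition int_Fmu (alpha : R) (d : nat) (mu : {measure set (RdB d) -> \bar R})
    (g : 'rV[R]_d -> R) : \bar R :=
  (\int[mu]_(z in @sphere d)
     \int[@lebesgue_measure R]_(r in [set r : R | (0 < r)%R])
        ((g (r *: (z : 'rV[R]_d)) * r `^ (- 1 - alpha))%R)%:E)%E.

Definition jump_sup (alpha Llo Lhi : R) (d : nat) (phi : 'rV[R]_d -> R)
    (x : 'rV[R]_d) : R :=
  sup [set v : R | exists mu : {measure set (RdB d) -> \bar R},
         admissible Llo Lhi mu /\ v = fine (int_Fmu alpha mu (jump_delta alpha phi x))].

Definition partial_sum (Omega : Type) (d : nat) (Z : nat -> Omega -> 'rV[R]_d)
    (n : nat) : Omega -> 'rV[R]_d :=
  fun w => \sum_(i < n) Z i w.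

End Defs.

(* Main.v *)
(** Write [T_h v x := E [v (x + h^(1/alpha) Z_1)]]. Independence turns
    [E [phi (x + (s/n)^(1/alpha) S_n)]] into the [n]-th iterate of [T_(s/n)] at
    [phi], and [T_h] is a sublinear, translation invariant contraction of
    bounded Lipschitz functions with [(T_h v - v) / h --> G v] for [v] in
    [C_b^3], by (A2). No further information on the generator [G] is needed.

    The key is to make this convergence uniform over the mollifications of all
    functions with given bounds. (A2) for finitely many test functions, together
    with the self-similarity of [T_h], bounds [(T_h v - v) / h] in terms of the
    size of [v] on a large ball; the mollifications of a totally bounded family
    are then controlled by finitely many of them. It follows that [T_(h/m)^m]
    and [T_h] agree up to [o(h)] on mollified functions, uniformly in [m], since
    both are [v + h G v] to first order.

    Existence of the limit is Krylov's argument: by Jensen's inequality the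
    mollified iterates of a sublinear translation invariant operator form a
    supersolution, so two such operators which are close on mollified functions
    have close iterates. Applied to [T_h] and [T_(h/m)^m] with [h = s/n], this
    compares the [n]-th and the [n m]-th approximations. *)
Require Import Defs.
From HB Require Import structures.
From mathcomp Require Import all_boot all_order all_algebra.
From mathcomp Require Import all_classical all_reals all_analysis.
From mathcomp Require Import ring lra.
Import Order.TTheory GRing.Theory Num.Theory.
Import numFieldNormedType.Exports.
Local Open Scope classical_set_scope.
Local Open Scope ring_scope.

Set Implicit Arguments.
Unset Strict Implicit.
Unset Printing Implicit Defensive.

(** * Bounded Lipschitz functions *)

Section matrix_norm.
Context {R : realType} {m n : nat}.
Implicit Types A : 'M[R]_(m, n).

Lemma ler_norm_entry A i j : `|A i j| <= `|A|.
Proof.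
rewrite [leRHS]/Num.norm/= mx_normrE; apply/bigmax_geP; right => /=.
by exists (i, j).
Qed.

Lemma ler_mx_norm A c : 0 <= c -> (forall i j, `|A i j| <= c) -> `|A| <= c.
Proof.
move=> c0 Ac; rewrite [leLHS]/Num.norm/= mx_normrE; apply/bigmax_leP.
by split=> // -[i j] _ /=.
Qed.

Lemma mx_norm_attained A : A != 0 -> exists i j, `|A| = `|A i j|.
Proof.
rewrite -normr_eq0 => /(mx_norm_neq0 (x := A))[[i j] AE].
by exists i, j; rewrite [LHS]AE.
Qed.

End matrix_norm.

Lemma ler_sum_ord_const (R : numDomainType) (n : nat) (F : 'I_n -> R) (c : R) :
  (forall i, F i <= c) -> \sum_i F i <= n%:R * c.
Proof.
move=> Fc; rewrite -[n in n%:R]card_ord mulr_natl -sumr_const.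
by apply: ler_sum => i _; exact: Fc.
Qed.

Lemma ler_norm_sum_ord_const (R : numDomainType) (V : normedZmodType R)
    (n : nat) (F : 'I_n -> V) (c : R) :
  (forall i, `|F i| <= c) -> `|\sum_i F i| <= n%:R * c.
Proof.
by move=> Fc; apply: le_trans (ler_norm_sum _ _ _) _; exact: ler_sum_ord_const.
Qed.

Lemma exists_small_factor (R : realFieldType) (c eta : R) : 0 <= c -> 0 < eta ->
  exists b : R, [/\ 0 < b, b <= 1 & c * b <= eta].
Proof.
move=> c0 eta0; have c1 : 0 < c + 1 by lra.
exists (Num.min 1 (eta / (c + 1))); set b := Num.min _ _.
have b0 : 0 < b by rewrite lt_min ltr01 divr_gt0.
split=> //; first by rewrite ge_min lexx.
have : b * (c + 1) <= eta by rewrite -ler_pdivlMr// ge_min lexx orbT.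
by lra.
Qed.

Section coordinate_telescoping.
Context {R : realType} {d : nat}.
Local Notation V := 'rV[R]_d.
Local Notation "''e_' i" := (delta_mx ord0 i : 'rV[R]_d) : ring_scope.
Implicit Types x y z : V.

Lemma norm_scale_delta_le (i : 'I_d) (t : R) : `|t *: 'e_i| <= `|t|.
Proof.
rewrite normrZ ler_piMr// ler_mx_norm// => j k; rewrite mxE.
by case: (_ && _); rewrite ?normr1 ?normr0.
Qed.

Definition trunc_row y (k : nat) : V :=
  \row_j (if (j < k)%N then y ord0 j else 0).

Lemma norm_trunc_row y k : `|trunc_row y k| <= `|y|.
Proof.
apply: ler_mx_norm => // i j; rewrite mxE; case: ifP => _.
  exact: ler_norm_entry.
by rewrite normr0.
Qed.

Lemma trunc_rowS y (i : 'I_d) :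
  trunc_row y i.+1 = trunc_row y i + y ord0 i *: 'e_i.
Proof.
apply/rowP => j; rewrite !mxE eqxx/= ltnS leq_eqVlt.
have [->|ji] := eqVneq j i; first by rewrite eqxx ltnn mulr1 add0r.
have /negbTE-> : nat_of_ord j != nat_of_ord i by [].
by rewrite mulr0 addr0.
Qed.

Lemma telescope_coord (f : V -> R) (a : 'I_d -> R) x y (B : R) :
  (forall i z, `|z| <= `|y| ->
     `|f (x + z + y ord0 i *: 'e_i) - f (x + z) - a i| <= B) ->
  `|f (x + y) - f x - \sum_i a i| <= d%:R * B.
Proof.
move=> fB; pose g k := f (x + trunc_row y k).
have -> : f (x + y) - f x = \sum_(i < d) (g i.+1 - g i).
  rewrite -(big_mkord xpredT (fun k => g k.+1 - g k)) telescope_sumr//.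
  congr (f (x + _) - f _); first by apply/rowP => j; rewrite !mxE ltn_ord.
  by rewrite -[LHS]addr0; congr +%R; apply/rowP => j; rewrite !mxE.
rewrite -sumrB; apply: ler_norm_sum_ord_const => i.
by rewrite /g trunc_rowS addrA; apply: fB; exact: norm_trunc_row.
Qed.

End coordinate_telescoping.

Lemma lipschitz_continuous (R : realFieldType) (U W : normedModType R) (L : R)
    (f : U -> W) :
  (forall x y, `|f x - f y| <= L * `|x - y|) -> continuous f.
Proof.
move=> fL x; apply/cvgrPdist_le => e e0.
have L0 : 0 < `|L| + 1 by rewrite ltr_wpDl.
apply/nbhs_ballP; exists (e / (`|L| + 1)); first exact: divr_gt0.
move=> y; rewrite -ball_normE/= ltr_pdivlMr// mulrC => /ltW xy.
apply: le_trans (fL _ _) _; apply: le_trans xy.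
by apply: ler_wpM2r => //; rewrite (le_trans (ler_norm L))// lerDl.
Qed.

Section bounded_lipschitz.
Context {R : realType} {m n : nat}.
Implicit Types (v w : 'M[R]_(m, n) -> R) (K L : R).

Definition blip K L v := [/\ 0 <= L, forall x, `|v x| <= K
  & forall x y, `|v x - v y| <= L * `|x - y|].

Lemma blip_bLip K L v : blip K L v -> bLip v.
Proof. by move=> [_ vK vL]; split; [exists K|exists L]. Qed.

Lemma bLip_blip v : bLip v -> exists K L : R, blip K L v.
Proof.
move=> [[K vK] [L vL]]; exists K, `|L|; split=> // x y.
by apply: le_trans (vL x y) _; apply: ler_wpM2r => //; exact: ler_norm.
Qed.

Lemma blip_ge0 K L v : blip K L v -> 0 <= K.
Proof. by move=> [_ vK _]; exact: le_trans (vK 0). Qed.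

Lemma blip_cst c : blip `|c| 0 (fun=> c).
Proof. by split=> // x y; rewrite subrr normr0 mul0r. Qed.

Lemma blip_affine K L v z a : blip K L v ->
  blip K (L * `|a|) (fun y => v (z + a *: y)).
Proof.
move=> [L0 vK vL]; split=> // [|x y]; first exact: mulr_ge0.
apply: le_trans (vL _ _) _.
by rewrite opprD addrACA subrr add0r -scalerBr normrZ mulrA.
Qed.

Lemma blip_shift K L v z : blip K L v -> blip K L (fun x => v (z + x)).
Proof.
move/(blip_affine z 1); rewrite normr1 mulr1.
by under eq_fun do rewrite scale1r.
Qed.

Lemma blipD K L K' L' v w :
  blip K L v -> blip K' L' w -> blip (K + K') (L + L') (fun x => v x + w x).
Proof.
move=> [L0 vK vL] [L'0 wK wL]; split=> [|x|x y]; first exact: addr_ge0.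
  by apply: le_trans (ler_normD _ _) _; apply: lerD.
rewrite opprD addrACA mulrDl.
by apply: le_trans (ler_normD _ _) _; apply: lerD.
Qed.

Lemma blipM K L K' L' v w : blip K L v -> blip K' L' w ->
  blip (K * K') (K * L' + L * K') (fun x => v x * w x).
Proof.
move=> vb wb; have K0 := blip_ge0 vb; have K'0 := blip_ge0 wb.
case: vb wb => [L0 vK vL] [L'0 wK wL]; split=> [|x|x y].
- by rewrite addr_ge0// mulr_ge0.
- by rewrite normrM; apply: ler_pM.
have -> : v x * w x - v y * w y = v x * (w x - w y) + (v x - v y) * w y by ring.
apply: le_trans (ler_normD _ _) _; rewrite !normrM mulrDl.
by apply: lerD; [rewrite -mulrA|rewrite mulrAC]; apply: ler_pM.
Qed.

Lemma blipZ K L v c : blip K L v ->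
  blip (`|c| * K) (`|c| * L) (fun x => c * v x).
Proof. by move=> /(blipM (blip_cst c)); rewrite mul0r addr0. Qed.

Lemma blipB K L K' L' v w :
  blip K L v -> blip K' L' w -> blip (K + K') (L + L') (fun x => v x - w x).
Proof.
move=> vb /(blipZ (-1)); rewrite normrN normr1 !mul1r => wb.
by have := blipD vb wb; under eq_fun do rewrite mulN1r.
Qed.

Lemma blipN K L v : blip K L v -> blip K L (fun x => - v x).
Proof.
move/(blipZ (-1)); rewrite normrN normr1 !mul1r.
by under eq_fun do rewrite mulN1r.
Qed.

Lemma bLip_cst c : @bLip R m n (fun=> c).
Proof. exact: blip_bLip (blip_cst c). Qed.

Lemma bLip_affine v z a : bLip v -> bLip (fun y => v (z + a *: y)).
Proof. by move=> /bLip_blip[K [L /(blip_affine z a)/blip_bLip]]. Qed.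

Lemma bLip_shift v z : bLip v -> bLip (fun x => v (z + x)).
Proof. by move=> /bLip_blip[K [L /(blip_shift z)/blip_bLip]]. Qed.

Lemma bLip_scale v a : bLip v -> bLip (fun y => v (a *: y)).
Proof. by move=> /(bLip_affine 0 a); under eq_fun do rewrite add0r. Qed.

Lemma bLipD v w : bLip v -> bLip w -> bLip (fun x => v x + w x).
Proof.
move=> /bLip_blip[K [L vb]] /bLip_blip[K' [L' wb]].
exact: blip_bLip (blipD vb wb).
Qed.

Lemma bLipB v w : bLip v -> bLip w -> bLip (fun x => v x - w x).
Proof.
move=> /bLip_blip[K [L vb]] /bLip_blip[K' [L' wb]].
exact: blip_bLip (blipB vb wb).
Qed.

Lemma bLipN v : bLip v -> bLip (fun x => - v x).
Proof. by move=> /bLip_blip[K [L /blipN/blip_bLip]]. Qed.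

Lemma bLipM v w : bLip v -> bLip w -> bLip (fun x => v x * w x).
Proof.
move=> /bLip_blip[K [L vb]] /bLip_blip[K' [L' wb]].
exact: blip_bLip (blipM vb wb).
Qed.

Lemma bLipZ c v : bLip v -> bLip (fun x => c * v x).
Proof. exact/bLipM/bLip_cst. Qed.

Lemma bLip_sum (I : Type) (r : seq I) (F : I -> 'M[R]_(m, n) -> R) :
  (forall i, bLip (F i)) -> bLip (fun x => \sum_(i <- r) F i x).
Proof.
move=> Fb; elim: r => [|i r ih].
  by under eq_fun do rewrite big_nil; exact: bLip_cst.
by under eq_fun do rewrite big_cons; exact: bLipD.
Qed.

Lemma blip_continuous K L v : blip K L v -> continuous v.
Proof. by move=> [_ _ vL]; exact: lipschitz_continuous vL. Qed.

End bounded_lipschitz.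

(** * Sliding averages *)

Section antiderivative.
Context {R : realType}.
Implicit Types F G f g : R -> R.

(* Only a half-line is considered because the Lebesgue integral from [l] to [t]
   is an antiderivative for [t > l] only. *)
Definition antiderivative (l : R) F g :=
  forall t : R, l < t -> is_derive t 1 F (g t).

Lemma antiderivative_exists l g : continuous g ->
  exists F, antiderivative l F g.
Proof.
move=> gc.
exists (fun x => \int[@lebesgue_measure R]_(t in `[l, x]) g t) => t lt_t.
have tt : t < t + 1 by rewrite ltrDl.
have ig : (@lebesgue_measure R).-integrable `[l, t + 1] (EFin \o g).
  apply: continuous_compact_integrable; first exact: segment_compact.
  exact: continuous_subspaceT.
have [dF FE] := continuous_FTC1_closed tt ig lt_t (gc t).
by apply: DeriveDef; [exact: dF|rewrite -derive1E; exact: FE].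
Qed.

Lemma antiderivative_within_continuous l F g a b : antiderivative l F g ->
  l < a -> {within `[a, b], continuous F}.
Proof.
move=> Fg la; apply: derivable_within_continuous => x.
by rewrite in_itv/= => /andP[ax _]; have [] := Fg x (lt_le_trans la ax).
Qed.

Lemma antiderivative_MVT l F g a b : antiderivative l F g -> l < a -> l < b ->
  exists2 c, `|c - a| <= `|b - a| & F b - F a = g c * (b - a).
Proof.
have mvt p q : antiderivative l F g -> l < p -> p <= q ->
    exists2 c, p <= c <= q & F q - F p = g c * (q - p).
  move=> Fg lp pq; have [||c] := @MVT_segment R F g p q pq.
  - by move=> x; rewrite in_itv/= => /andP[px _]; apply: Fg; exact: lt_trans px.
  - exact: antiderivative_within_continuous Fg lp.
  by rewrite in_itv/=; exists c.
move=> Fg la lb; have [ab|/ltW ba] := leP a b.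
- have [c /andP[ac cb] FE] := mvt a b Fg la ab.
  by exists c => //; rewrite !ger0_norm ?subr_ge0//; lra.
- have [c /andP[bc ca] FE] := mvt b a Fg lb ba.
  exists c; first by rewrite !ler0_norm ?subr_le0//; lra.
  by rewrite -opprB FE; ring.
Qed.

Lemma antiderivative_taylor l F g L a t :
  antiderivative l F g -> l < a -> l < a + t ->
  0 <= L -> (forall r, `|g r - g a| <= L * `|r - a|) ->
  `|F (a + t) - F a - t * g a| <= L * t ^+ 2.
Proof.
move=> Fg la lat L0 gL; have [c] := antiderivative_MVT Fg la lat.
rewrite [a + t - a](_ : _ = t); last by ring.
move=> ct ->; rewrite [_ * t]mulrC -mulrBr normrM mulrC.
rewrite -[t ^+ 2]real_normK ?num_real// expr2 mulrA ler_wpM2r//.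
by rewrite (le_trans (gL c))// ler_wpM2l.
Qed.

Lemma antiderivativeD l F G f g :
  antiderivative l F f -> antiderivative l G g ->
  antiderivative l (fun t => F t + G t) (fun t => f t + g t).
Proof. by move=> Ff Gg t lt_t; apply: is_deriveD; [exact: Ff|exact: Gg]. Qed.

Lemma antiderivativeZ l F f c : antiderivative l F f ->
  antiderivative l (fun t => c * F t) (fun t => c * f t).
Proof. by move=> Ff t lt_t; apply: is_deriveZ; exact: Ff. Qed.

Lemma antiderivative_shift l F f c : antiderivative l F f ->
  antiderivative (l - c) (fun t => F (c + t)) (fun t => f (c + t)).
Proof.
move=> Ff t; rewrite ltrBlDl => lt_t.
have dc : is_derive t 1 (fun r : R => c + r) 1.
  have -> : (fun r : R => c + r) = shift c.
    by apply/funext => r /=; rewrite addrC.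
  exact: is_derive_shift.
rewrite -[f _]mulr1; exact: (is_derive1_comp (Ff _ lt_t) dc).
Qed.

Lemma Rintegral_antiderivative l F f a b : l < a -> a < b -> continuous f ->
  antiderivative l F f ->
  \int[@lebesgue_measure R]_(t in `[a, b]) f t = F b - F a.
Proof.
move=> la ab fc Ff; have Fab := antiderivative_within_continuous (b := b) Ff la.
rewrite /Rintegral (@continuous_FTC2 _ f F)//.
- exact: continuous_subspaceT.
- have /(continuous_within_itvP F ab)[_ Fa Fb] := Fab; split=> //.
  move=> t; rewrite in_itv/= => /andP[a_t _].
  by have [] := Ff t (lt_trans la a_t).
- move=> t; rewrite in_itv/= => /andP[a_t _].
  by rewrite derive1E; have [] := Ff t (lt_trans la a_t).
Qed.

End antiderivative.

Section sliding_averages.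
Context {R : realType} {d : nat}.
Variable eps : R.
Hypothesis eps_gt0 : 0 < eps.
Local Notation V := 'rV[R]_d.
Local Notation "''e_' i" := (delta_mx ord0 i : 'rV[R]_d) : ring_scope.
Implicit Types (v w f g : V -> R) (x y z : V) (i j : 'I_d) (W : seq 'I_d).

Definition line v x i (r : R) : R := v (x + r *: 'e_i).

Lemma line_lipschitz K L v x i : blip K L v ->
  forall r s, `|line v x i r - line v x i s| <= L * `|r - s|.
Proof.
move=> [L0 _ vL] r s; apply: le_trans (vL _ _) _; apply: ler_wpM2l => //.
by rewrite opprD addrACA subrr add0r -scalerBl norm_scale_delta_le.
Qed.

Lemma line_continuous v x i : bLip v -> continuous (line v x i).
Proof.
by move=> /bLip_blip[K [L /line_lipschitz vL]]; exact: lipschitz_continuous.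
Qed.

(* Sliding averages replace convolution with a mollifier: they are limits of
   convex combinations of translates, and each of them gains a derivative in
   its direction. *)
Definition avg i v x : R :=
  eps^-1 * \int[@lebesgue_measure R]_(r in `[0, eps]) line v x i r.

Lemma avgE l v x i F : l < 0 -> bLip v -> antiderivative l F (line v x i) ->
  avg i v x = eps^-1 * (F eps - F 0).
Proof.
move=> l0 vb Fv; rewrite /avg (Rintegral_antiderivative l0 eps_gt0 _ Fv)//.
exact: line_continuous.
Qed.

Lemma avg_antiderivative l v x i : l < 0 -> bLip v ->
  exists2 F, antiderivative l F (line v x i) &
    avg i v x = eps^-1 * (F eps - F 0).
Proof.
move=> l0 vb; have lc : continuous (line v x i) by exact: line_continuous.
have [F Fv] := antiderivative_exists l lc.
by exists F => //; exact: avgE Fv.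
Qed.

Lemma avg_mean v x i : bLip v ->
  exists2 c, `|c| <= eps & avg i v x = line v x i c.
Proof.
move=> vb; have [F Fv ->] := avg_antiderivative x i (ltrN10 R) vb.
have [|c] := antiderivative_MVT Fv (ltrN10 R) (b := eps).
  exact: lt_trans (ltrN10 R) eps_gt0.
rewrite !subr0 (gtr0_norm eps_gt0) => ceps ->; exists c => //.
by rewrite mulrC mulfK// gt_eqF.
Qed.

Lemma avgD v w i : bLip v -> bLip w ->
  avg i (fun x => v x + w x) = fun x => avg i v x + avg i w x.
Proof.
move=> vb wb; apply/funext => x.
have [F Fv ->] := avg_antiderivative x i (ltrN10 R) vb.
have [G Gw ->] := avg_antiderivative x i (ltrN10 R) wb.
by rewrite (avgE (ltrN10 R) (bLipD vb wb) (antiderivativeD Fv Gw)); ring.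
Qed.

Lemma avgZ v i c : bLip v -> avg i (fun x => c * v x) = fun x => c * avg i v x.
Proof.
move=> vb; apply/funext => x.
have [F Fv ->] := avg_antiderivative x i (ltrN10 R) vb.
by rewrite (avgE (ltrN10 R) (bLipZ c vb) (antiderivativeZ c Fv)); ring.
Qed.

Lemma avg_shift v i z : avg i (fun x => v (z + x)) = fun x => avg i v (z + x).
Proof.
apply/funext => x; rewrite /avg; congr (_ * Rintegral _ _ _).
by apply/funext => r; rewrite /line addrA.
Qed.

Lemma avgB v w i : bLip v -> bLip w ->
  avg i (fun x => v x - w x) = fun x => avg i v x - avg i w x.
Proof.
move=> vb wb; under eq_fun do rewrite -mulN1r.
rewrite avgD ?avgZ//; last exact: bLipZ.
by apply/funext => x; rewrite mulN1r.
Qed.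

Lemma blip_avg K L v i : blip K L v -> blip K L (avg i v).
Proof.
move=> vKL; have [L0 vK vL] := vKL; have vb := blip_bLip vKL.
split=> // [x|x y]; first by have [c _ ->] := avg_mean x i vb; exact: vK.
have yb := bLip_shift (y - x) vb.
have -> : avg i v x - avg i v y = avg i (fun z => v z - v (y - x + z)) x.
  by rewrite avgB// avg_shift subrK.
have [c _ ->] := avg_mean x i (bLipB vb yb).
by rewrite /line (le_trans (vL _ _))// opprD addrCA subrr addr0 opprB.
Qed.

Lemma bLip_avg v i : bLip v -> bLip (avg i v).
Proof. by move=> /bLip_blip[K [L /(blip_avg i)/blip_bLip]]. Qed.

Lemma avg_mono v w i : bLip v -> bLip w -> (forall x, v x <= w x) ->
  forall x, avg i v x <= avg i w x.
Proof.
move=> vb wb vw x; rewrite -subr_ge0.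
have -> : avg i w x - avg i v x = avg i (fun y => w y - v y) x by rewrite avgB.
have [c _ ->] := avg_mean x i (bLipB wb vb).
by rewrite /line subr_ge0.
Qed.

Definition has_partial (C : R) f i g :=
  forall x (t : R), `|f (x + t *: 'e_i) - f x - t * g x| <= C * t ^+ 2.

Definition diffq i v x : R := eps^-1 * (v (eps *: 'e_i + x) - v x).

Lemma avg_has_partial K L v i : blip K L v ->
  has_partial (2 * L / eps) (avg i v) i (diffq i v).
Proof.
move=> vKL x t; have [L0 _ _] := vKL; have vb := blip_bLip vKL.
have tN := ler_norm (- t); rewrite normrN in tN.
have l0 : - 1 - `|t| < 0 by have := normr_ge0 t; lra.
have [F Fv ->] := avg_antiderivative x i l0 vb.
have lt0 : - 1 - `|t| - t < 0 by lra.
have Ft : antiderivative (- 1 - `|t| - t) (fun r => F (t + r))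
    (line v (x + t *: 'e_i) i).
  have := antiderivative_shift (c := t) Fv.
  by rewrite /line; under [fun r => v _]eq_fun do rewrite scalerDl addrA.
rewrite (avgE lt0 vb Ft) addr0 [t + eps]addrC.
have l_eps := lt_trans l0 eps_gt0.
have l_epst : - 1 - `|t| < eps + t.
  by have := eps_gt0; lra.
have l0t : - 1 - `|t| < 0 + t by lra.
have lineL := line_lipschitz x i vKL.
have at_eps := antiderivative_taylor Fv l_eps l_epst L0 (lineL^~ _).
have at_0 := antiderivative_taylor Fv l0 l0t L0 (lineL^~ _).
rewrite /line scale0r addr0 add0r in at_0.
rewrite /line [x + eps *: _]addrC in at_eps.
rewrite /diffq -mulrBr mulrCA -mulrBr normrM normfV (gtr0_norm eps_gt0).
rewrite [2 * L / eps * _](_ : _ = eps^-1 * (2 * (L * t ^+ 2))); last by ring.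
rewrite ler_pM2l ?invr_gt0//.
move: at_eps at_0; rewrite !ler_norml => /andP[? ?] /andP[? ?].
by apply/andP; split; lra.
Qed.

Lemma avg_preserves_partial C f g i j : bLip f -> bLip g ->
  has_partial C f j g -> has_partial C (avg i f) j (avg i g).
Proof.
move=> fb gb fg x t; have tfb := bLip_shift (t *: 'e_j) fb.
have -> : avg i f (x + t *: 'e_j) - avg i f x - t * avg i g x =
    avg i (fun y => f (t *: 'e_j + y) - f y - t * g y) x.
  rewrite avgB; [|exact: bLipB|exact: bLipZ].
  by rewrite avgB// avg_shift avgZ// [_ + x]addrC.
have [c _ ->] := avg_mean x i (bLipB (bLipB tfb fb) (bLipZ t gb)).
by rewrite /line [t *: _ + _]addrC; exact: fg.
Qed.

Definition riemann N i v x : R :=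
  N%:R^-1 * \sum_(k < N) v (eps * k%:R / N%:R *: 'e_i + x).

Lemma avg_riemann K L v i x N : blip K L v ->
  `|avg i v x - riemann N.+1 i v x| <= L * eps / N.+1%:R.
Proof.
move=> vKL; have [L0 _ _] := vKL; have vb := blip_bLip vKL.
have [F Fv ->] := avg_antiderivative x i (ltrN10 R) vb.
pose tau := eps / N.+1%:R; have tau0 : 0 < tau by exact: divr_gt0.
have -> : F eps - F 0 = \sum_(k < N.+1) (F (tau * k.+1%:R) - F (tau * k%:R)).
  rewrite -(big_mkord xpredT (fun k => F (tau * k.+1%:R) - F (tau * k%:R))).
  rewrite (telescope_sumr (fun k => F (tau * k%:R)))//.
  by rewrite mulr0 /tau divfK// gt_eqF.
have -> : eps^-1 * (\sum_(k < N.+1) (F (tau * k.+1%:R) - F (tau * k%:R)))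
    - riemann N.+1 i v x
  = eps^-1 * \sum_(k < N.+1) (F (tau * k.+1%:R) - F (tau * k%:R)
      - tau * line v x i (tau * k%:R)).
  rewrite /riemann [RHS]mulr_sumr mulr_sumr [in X in _ - X]mulr_sumr -sumrB.
  apply: eq_bigr => k _; rewrite /line [x + _]addrC.
  have -> : eps * k%:R / N.+1%:R = tau * k%:R by rewrite /tau; ring.
  by rewrite /tau; field; rewrite !gt_eqF.
rewrite normrM normfV (gtr0_norm eps_gt0) ler_pdivrMl//.
have -> : eps * (L * eps / N.+1%:R) = N.+1%:R * (L * tau ^+ 2).
  by rewrite /tau; field; rewrite gt_eqF.
apply: ler_norm_sum_ord_const => k; rewrite -natr1 mulrDr mulr1.
have k0 : 0 <= tau * k%:R by rewrite mulr_ge0// ltW.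
apply: (antiderivative_taylor Fv _ _ L0); [lra|lra|].
by move=> r; exact: line_lipschitz vKL _ _.
Qed.

Definition avgs W v : V -> R := foldr avg v W.

Lemma blip_avgs K L v W : blip K L v -> blip K L (avgs W v).
Proof. by move=> vb; elim: W => //= i W; exact: blip_avg. Qed.

Lemma bLip_avgs v W : bLip v -> bLip (avgs W v).
Proof. by move=> vb; elim: W => //= i W; exact: bLip_avg. Qed.

Lemma avgsZ v W c : bLip v ->
  avgs W (fun x => c * v x) = fun x => c * avgs W v x.
Proof.
by move=> vb; elim: W => //= i W ->; rewrite avgZ//; exact: bLip_avgs.
Qed.

Lemma avgsB v w W : bLip v -> bLip w ->
  avgs W (fun x => v x - w x) = fun x => avgs W v x - avgs W w x.
Proof.
by move=> vb wb; elim: W => //= i W ->; rewrite avgB//; exact: bLip_avgs.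
Qed.

Lemma avgsN v W : bLip v -> avgs W (fun x => - v x) = fun x => - avgs W v x.
Proof.
move=> vb; have -> : (fun x => - v x) = fun x => -1 * v x.
  by apply/funext => x; rewrite mulN1r.
by rewrite avgsZ//; apply/funext => x; rewrite mulN1r.
Qed.

Lemma avgs_shift v W z :
  avgs W (fun x => v (z + x)) = fun x => avgs W v (z + x).
Proof. by elim: W => //= i W ->; rewrite avg_shift. Qed.

Lemma avgs_mean v W x : bLip v ->
  exists2 y, `|y - x| <= eps * (size W)%:R & avgs W v x = v y.
Proof.
move=> vb; elim: W x => [|i W ih] x /=.
  by exists x => //; rewrite subrr normr0 mulr0.
have [c ceps ->] := avg_mean x i (bLip_avgs W vb).
have [y yx vy] := ih (x + c *: 'e_i); exists y => //.
rewrite -(subrKA (x + c *: 'e_i)) -natr1 mulrDr mulr1.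
apply: le_trans (ler_normD _ _) _; apply: lerD => //.
rewrite addrAC subrr add0r.
exact: le_trans (norm_scale_delta_le _ _) ceps.
Qed.

Lemma blip_diffq K L v i : blip K L v ->
  blip (2 * K / eps) (2 * L / eps) (diffq i v).
Proof.
move=> vb; have e0 : 0 < eps^-1 by rewrite invr_gt0.
have doubleE (q : R) : 2 * q / eps = eps^-1 * (q + q) by ring.
rewrite !doubleE -(gtr0_norm e0).
exact: blipZ _ (blipB (blip_shift (eps *: 'e_i) vb) vb).
Qed.

Lemma bLip_diffq v i : bLip v -> bLip (diffq i v).
Proof. by move=> /bLip_blip[K [L /(blip_diffq i)/blip_bLip]]. Qed.

Lemma diffq_avgs v W i : bLip v -> diffq i (avgs W v) = avgs W (diffq i v).
Proof.
move=> vb; have eb := bLip_shift (eps *: 'e_i) vb.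
by rewrite /diffq avgsZ ?avgsB ?avgs_shift//; exact: bLipB.
Qed.

Lemma avgs_has_partial K L v W i : blip K L v -> i \in W ->
  has_partial (2 * L / eps) (avgs W v) i (avgs (rem i W) (diffq i v)).
Proof.
move=> vKL; have vb := blip_bLip vKL; elim: W => //= j W ih.
rewrite inE; case: eqVneq => [-> _|ji /= iW].
  by rewrite -diffq_avgs//; exact: avg_has_partial (blip_avgs W vKL).
apply: avg_preserves_partial; [exact: bLip_avgs| |exact: ih].
by apply: bLip_avgs; exact: bLip_diffq.
Qed.

End sliding_averages.

(** * Mollification into [C_b^3] *)

Section partial_derivatives.
Context {R : realType} {d : nat}.
Local Notation V := 'rV[R]_d.
Local Notation "''e_' i" := (delta_mx ord0 i : 'rV[R]_d) : ring_scope.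
Implicit Types (f g v : V -> R) (x y z : V) (i j : 'I_d) (s W : seq 'I_d).

Lemma has_partial_derive C f i g x : has_partial C f i g ->
  is_derive x 'e_i f (g x).
Proof.
move=> fg.
suff cvg_g : h^-1 *: (f (h *: 'e_i + x) - f x) @[h --> 0^'] --> g x.
  by apply: DeriveDef; [exact: cvgP cvg_g|exact: cvg_lim cvg_g].
apply/cvgrPdist_le => e e0; have C0 : 0 < `|C| + 1 by rewrite ltr_wpDl.
near=> h.
have h0 : 0 < `|h| by rewrite normr_gt0; near: h; exact: nbhs_dnbhs_neq.
have he : (`|C| + 1) * `|h| <= e.
  by rewrite mulrC -ler_pdivlMr//; near: h; apply: dnbhs0_le; exact: divr_gt0.
have := fg x h; rewrite [x + _]addrC; set D := f _ - f x => DC.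
have -> : g x - h^-1 *: D = - (h^-1 * (D - h * g x)).
  by rewrite /GRing.scale/=; field; rewrite -normr_gt0.
rewrite normrN normrM normfV ler_pdivrMl//.
apply: le_trans DC _; rewrite -real_normK ?num_real// expr2 mulrCA.
apply: ler_wpM2l => //; apply: le_trans he; apply: ler_wpM2r => //.
by rewrite (le_trans (ler_norm C))// lerDl.
Unshelve. all: by end_near. Qed.

Lemma line_derive f i z r : derivable f (z + r *: 'e_i) 'e_i ->
  is_derive r 1 (line f z i) (partial f i (z + r *: 'e_i)).
Proof.
move=> df.
have quotE :
    (fun h : R => h^-1 *: (line f z i (h *: (1 : R) + r) - line f z i r))
    = (fun h => h^-1 *: (f (h *: 'e_i + (z + r *: 'e_i)) - f (z + r *: 'e_i))).
  apply/funext => h; congr (_ *: (f _ - _)).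
  by rewrite [h *: (1 : R)]mulr1 scalerDl addrCA.
by apply: DeriveDef; rewrite /derivable /derive /= quotE.
Qed.

Lemma Cb3_bLip f : Cb3 f -> bLip f.
Proof.
move=> fC; have [fd _ fK] := fC [::] isT; split=> //.
have /choice[M fM] : forall i, exists M : R, forall x, `|partial f i x| <= M.
  by move=> i; have [_ _] := fC [:: i] isT.
exists (d%:R * \sum_i `|M i|) => x y.
have -> : f x - f y = f (y + (x - y)) - f y - \sum_(i < d) 0.
  by rewrite big1_eq subr0 [y + _]addrC subrK.
rewrite -mulrA; apply: telescope_coord => i z _; rewrite subr0.
set t := (x - y) ord0 i.
have Ff : antiderivative (- 1 - `|t|) (line f (y + z) i)
    (fun r => partial f i (y + z + r *: 'e_i)).
  by move=> r _; apply: line_derive; exact: fd.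
have t0 := normr_ge0 t; have tN := ler_norm (- t); rewrite normrN in tN.
have [||c _] := antiderivative_MVT Ff (a := 0) (b := t); [lra|lra|].
rewrite /line scale0r addr0 subr0 => ->; rewrite normrM.
apply: ler_pM => //; last exact: ler_norm_entry.
rewrite (le_trans (fM i _))// (le_trans (ler_norm _))//.
by rewrite (bigD1 i)//= lerDl sumr_ge0.
Qed.

Variable eps : R.
Hypothesis eps_gt0 : 0 < eps.

(* One sliding average in a direction yields one derivative in this direction,
   hence three of them in each. *)
Definition avg_directions : seq 'I_d := enum 'I_d ++ enum 'I_d ++ enum 'I_d.

Lemma count_avg_directions i : count_mem i avg_directions = 3%N.
Proof. by rewrite !count_cat !count_uniq_mem ?enum_uniq// mem_enum. Qed.

Lemma mem_avg_directions i : i \in avg_directions.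
Proof. by rewrite mem_cat mem_enum. Qed.

Definition rem_seq W s := foldr (fun i W => rem i W) W s.

Lemma mem_rem_seq W s i :
  (i \in rem_seq W s) = (count_mem i s < count_mem i W)%N.
Proof.
have count_rem_seq j :
    count_mem j (rem_seq W s) = (count_mem j W - count_mem j s)%N.
  elim: s => [|k s ih] /=; first by rewrite subn0.
  by rewrite count_mem_rem ih subnAC -subnDA addnC.
by rewrite -has_pred1 has_count count_rem_seq subn_gt0.
Qed.

Lemma bLip_diffqs v s : bLip v -> bLip (foldr (diffq eps) v s).
Proof. by move=> vb; elim: s => //= i s; exact: bLip_diffq. Qed.

Lemma avgs_rem_seq_derive v W s i x : bLip v -> i \in rem_seq W s ->
  is_derive x 'e_i (avgs eps (rem_seq W s) (foldr (diffq eps) v s))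
    (avgs eps (rem_seq W (i :: s)) (foldr (diffq eps) v (i :: s)) x).
Proof.
move=> /(bLip_diffqs s)/bLip_blip[K [L vKL]] iW.
exact: has_partial_derive (avgs_has_partial eps_gt0 vKL iW).
Qed.

Lemma iter_partial_avgs v W s : bLip v ->
  (forall i, (count_mem i s <= count_mem i W)%N) ->
  iter_partial (avgs eps W v) s =
  avgs eps (rem_seq W s) (foldr (diffq eps) v s).
Proof.
move=> vb; elim: s => // i s ih sW.
have sW' j : (count_mem j s <= count_mem j W)%N.
  by apply: leq_trans (sW j); rewrite leq_addl.
rewrite [LHS]/= ih//; apply/funext => x; rewrite /partial.
have iW : i \in rem_seq W s by have := sW i; rewrite mem_rem_seq /= eqxx add1n.
by have [_ ->] := avgs_rem_seq_derive x vb iW.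
Qed.

Lemma Cb3_mollify v : bLip v -> Cb3 (avgs eps avg_directions v).
Proof.
move=> vb s s3.
have sW i : (count_mem i s <= count_mem i avg_directions)%N.
  by rewrite count_avg_directions; apply: leq_trans s3; exact: count_size.
have [K [L sKL]] := bLip_blip (bLip_diffqs s vb).
have aKL := blip_avgs eps_gt0 (rem_seq avg_directions s) sKL.
rewrite iter_partial_avgs//; split; last 2 first.
- exact: blip_continuous aKL.
- by exists K; case: aKL.
move=> s_lt3 i x; have iW : i \in rem_seq avg_directions s.
  rewrite mem_rem_seq count_avg_directions.
  by apply: leq_ltn_trans s_lt3; exact: count_size.
by have [] := avgs_rem_seq_derive x vb iW.
Qed.

End partial_derivatives.

Notation mollify eps := (avgs eps avg_directions).

Definition mollify_radius {R : realType} (d : nat) (eps : R) : R :=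
  eps * (size (@avg_directions d))%:R.

Section mollification.
Context {R : realType} {d : nat}.
Local Notation V := 'rV[R]_d.
Implicit Types (v : V -> R) (x : V).

Lemma mollify_mean eps v x : 0 < eps -> bLip v ->
  exists2 y, `|y - x| <= mollify_radius d eps & mollify eps v x = v y.
Proof. by move=> eps0; exact: avgs_mean. Qed.

Lemma mollify_close eps K L v x : 0 < eps -> blip K L v ->
  `|mollify eps v x - v x| <= L * mollify_radius d eps.
Proof.
move=> eps0 vKL; have [L0 _ vL] := vKL.
have [y yx ->] := mollify_mean x eps0 (blip_bLip vKL).
by apply: le_trans (vL _ _) _; exact: ler_wpM2l.
Qed.

Lemma mollify_cst eps c x : 0 < eps -> mollify eps (fun _ : V => c) x = c.
Proof. by move=> eps0; have [y _ ->] := mollify_mean x eps0 (bLip_cst c). Qed.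

End mollification.

Lemma exists_small_radius {R : realType} (d : nat) (c eta : R) :
  0 <= c -> 0 < eta ->
  exists2 eps, 0 < eps & c * mollify_radius d eps <= eta.
Proof.
move=> c0 eta0; have [|eps [eps0 _ eps_small]] := @exists_small_factor R
  (c * (size (@avg_directions d))%:R) eta _ eta0; first exact: mulr_ge0.
by exists eps => //; rewrite /mollify_radius [eps * _]mulrC mulrA.
Qed.

(** * Translation invariant sublinear operators *)

Section sublinear_operators.
Context {R : realType} {d : nat}.
Local Notation V := 'rV[R]_d.
Implicit Types (v w g phi : V -> R) (x y z : V) (S T : (V -> R) -> V -> R).

Definition sublinear_operator T :=
  [/\ forall v w, bLip v -> bLip w -> (forall x, v x <= w x) ->
        forall x, T v x <= T w x,
      forall c x, T (fun=> c) x = c,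
      forall v w x, bLip v -> bLip w ->
        T (fun y => v y + w y) x <= T v x + T w x,
      forall c v x, bLip v -> 0 <= c -> T (fun y => c * v y) x = c * T v x
    & forall v z, T (fun y => v (z + y)) = fun x => T v (z + x)].

Section one_operator.
Variable T : (V -> R) -> V -> R.
Hypothesis T_sub : sublinear_operator T.

Lemma sublin_mono v w : bLip v -> bLip w -> (forall x, v x <= w x) ->
  forall x, T v x <= T w x.
Proof. by case: T_sub => + _ _ _ _; exact. Qed.

Lemma sublin_cst c x : T (fun=> c) x = c.
Proof. by case: T_sub. Qed.

Lemma sublinD v w x : bLip v -> bLip w ->
  T (fun y => v y + w y) x <= T v x + T w x.
Proof. by case: T_sub => _ _ + _ _; exact. Qed.

Lemma sublinZ c v x : bLip v -> 0 <= c -> T (fun y => c * v y) x = c * T v x.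
Proof. by case: T_sub => _ _ _ + _; exact. Qed.

Lemma sublin_shift v z : T (fun y => v (z + y)) = fun x => T v (z + x).
Proof. by case: T_sub. Qed.

Lemma sublinB v w x : bLip v -> bLip w ->
  T v x - T w x <= T (fun y => v y - w y) x.
Proof.
move=> vb wb; rewrite lerBlDr; apply: le_trans (sublinD _ (bLipB vb wb) wb).
by under [X in _ <= T X _]eq_fun do rewrite subrK.
Qed.

Lemma sublin_addc v c x : bLip v -> T (fun y => v y + c) x = T v x + c.
Proof.
move=> vb; have cb : bLip (fun _ : V => c) := bLip_cst c.
apply/eqP; rewrite eq_le; apply/andP; split.
  by apply: le_trans (sublinD _ vb cb) _; rewrite sublin_cst.
have := sublinD x (bLipD vb cb) (bLip_cst (- c)).
by under [X in T X _ <= _]eq_fun do rewrite addrK; rewrite sublin_cst lerBrDr.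
Qed.

Lemma sublin_le_addc v w c : bLip v -> bLip w -> (forall x, v x <= w x + c) ->
  forall x, T v x <= T w x + c.
Proof.
move=> vb wb vw x; rewrite -sublin_addc//.
by apply: sublin_mono => //; apply: bLipD => //; exact: bLip_cst.
Qed.

Lemma sublin_contraction v w B : bLip v -> bLip w ->
  (forall x, `|v x - w x| <= B) -> forall x, `|T v x - T w x| <= B.
Proof.
move=> vb wb vw x; rewrite ler_norml lerBlDl lerBrDl lerBlDr; apply/andP; split.
  apply: sublin_le_addc => // y.
  by have := vw y; rewrite ler_norml lerBrDl lerBlDr => /andP[].
apply: sublin_le_addc => // y.
by have := vw y; rewrite ler_norml lerBlDl => /andP[].
Qed.

Lemma blip_sublin K L v : blip K L v -> blip K L (T v).
Proof.
move=> vKL; have [L0 vK vL] := vKL; have vb := blip_bLip vKL.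
split=> // [x|x y].
  have := sublin_contraction vb (bLip_cst 0) (B := K) _ x.
  by rewrite sublin_cst subr0; apply=> z; rewrite subr0.
have -> : T v x = T (fun z => v (x - y + z)) y by rewrite sublin_shift subrK.
apply: sublin_contraction => //; first exact: bLip_shift.
by move=> z; apply: le_trans (vL _ _) _; rewrite addrK.
Qed.

Lemma bLip_sublin v : bLip v -> bLip (T v).
Proof. by move=> /bLip_blip[K [L /blip_sublin/blip_bLip]]. Qed.

Lemma blip_iter_sublin n K L v : blip K L v -> blip K L (iter n T v).
Proof. by move=> vb; elim: n => //= n; exact: blip_sublin. Qed.

Lemma sublin_sum (I : Type) (r : seq I) (F : I -> V -> R) x :
  (forall i, bLip (F i)) ->
  T (fun y => \sum_(i <- r) F i y) x <= \sum_(i <- r) T (F i) x.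
Proof.
move=> Fb; elim: r => [|i r ih].
  by under [X in T X]eq_fun do rewrite big_nil; rewrite big_nil sublin_cst.
under [X in T X]eq_fun do rewrite big_cons.
rewrite big_cons.
apply: le_trans (sublinD _ _ _) _ => //; first exact: bLip_sum.
by rewrite lerD2l.
Qed.

Lemma sublinZ_le a v c x : bLip v -> T v x <= c -> T (fun y => - v y) x <= c ->
  T (fun y => a * v y) x <= `|a| * c.
Proof.
move=> vb Tv TNv; have [a0|/ltW a0] := leP 0 a.
  by rewrite sublinZ// ger0_norm// ler_wpM2l.
rewrite ler0_norm//; under [X in T X]eq_fun do rewrite -mulrNN.
by rewrite sublinZ ?oppr_ge0//; [rewrite ler_wpM2l// oppr_ge0|exact: bLipN].
Qed.

Lemma sublin_perturb phi g t c x : bLip phi -> bLip g -> 0 <= t ->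
  T g x <= g x + c -> T (fun y => - g y) x <= - g x + c ->
  `|T (fun y => phi y + t * g y) x - T phi x - t * g x| <= t * c.
Proof.
move=> phib gb t0 Tg TNg; have tgb := bLipZ t gb.
have upper := sublinD x phib tgb; rewrite sublinZ// in upper.
have lower := sublinD x (bLipD phib tgb) (bLipZ t (bLipN gb)).
rewrite sublinZ// in lower; last exact: bLipN.
have cancel : (fun y => phi y + t * g y + t * - g y) = phi.
  by apply/funext => y; rewrite mulrN addrK.
rewrite cancel in lower.
have := ler_wpM2l t0 Tg; have := ler_wpM2l t0 TNg; rewrite !mulrDr mulrN.
by rewrite ler_norml => ? ?; apply/andP; split; lra.
Qed.

(* [phi + k h g] is an approximate trajectory of the iteration. *)
Lemma iter_expansion phi g h eta c : bLip phi -> bLip g -> 0 <= h ->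
  (forall x, `|T phi x - phi x - h * g x| <= h * eta) ->
  (forall x, T g x <= g x + c) ->
  (forall x, T (fun y => - g y) x <= - g x + c) ->
  forall n x, `|iter n T phi x - phi x - n%:R * h * g x|
    <= n%:R * h * (eta + n%:R * c).
Proof.
move=> phib gb h0 phi_rate g_rate Ng_rate; elim=> [|n ih] x.
  by rewrite /= subrr !mul0r subr0 normr0.
have nh0 : 0 <= n%:R * h by rewrite mulr_ge0.
have c0 : 0 <= c.
  have := sublinD 0 gb (bLipN gb).
  under [X in T X _ <= _]eq_fun do rewrite subrr.
  by rewrite sublin_cst; have := g_rate 0; have := Ng_rate 0; lra.
have [K [L phiKL]] := bLip_blip phib.
have itb : bLip (iter n T phi) by exact: blip_bLip (blip_iter_sublin n phiKL).
have pgb := bLipD phib (bLipZ (n%:R * h) gb).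
have : `|T (iter n T phi) x - T (fun y => phi y + n%:R * h * g y) x| <=
    n%:R * h * (eta + n%:R * c).
  by apply: sublin_contraction => // y; rewrite opprD addrA.
have := sublin_perturb phib gb nh0 (g_rate x) (Ng_rate x).
have := phi_rate x; rewrite /= -natr1.
move: (T _ x) (T _ x) (T _ x) => p q r; rewrite !ler_norml.
have : 0 <= h * c * (n%:R + 1) by rewrite !mulr_ge0// addr_ge0.
by move=> ? /andP[? ?] /andP[? ?] /andP[? ?]; apply/andP; split; lra.
Qed.

End one_operator.

Lemma sublinear_operator_comp S T :
  sublinear_operator S -> sublinear_operator T ->
  sublinear_operator (S \o T).
Proof.
move=> S_sub T_sub; split=> /= [v w vb wb vw|c x|v w x vb wb|c v x vb c0|v z].
- apply: sublin_mono => //; [exact: bLip_sublin|exact: bLip_sublin|].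
  exact: sublin_mono.
- have -> : T (fun=> c) = fun=> c by apply/funext => y; exact: sublin_cst.
  exact: sublin_cst.
- have vwb := bLipD vb wb.
  have Tvb := bLip_sublin T_sub vb; have Twb := bLip_sublin T_sub wb.
  apply: le_trans (sublinD S_sub x Tvb Twb).
  apply: sublin_mono => // [||y]; [exact: bLip_sublin|exact: bLipD|].
  exact: sublinD.
- rewrite -(sublinZ S_sub)//; last exact: bLip_sublin.
  by congr (S _ x); apply/funext => y; exact: sublinZ.
- by rewrite !sublin_shift.
Qed.

Lemma sublinear_operator_iter n T :
  sublinear_operator T -> sublinear_operator (iter n T).
Proof.
move=> T_sub; elim: n => [|n ih]; first by split.
exact: (sublinear_operator_comp T_sub ih).
Qed.

Section averages.
Variables (eps : R) (T : (V -> R) -> V -> R).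
Hypotheses (eps_gt0 : 0 < eps) (T_sub : sublinear_operator T).

Lemma sublin_riemann N i v x : bLip v ->
  T (riemann eps N i v) x <= riemann eps N i (T v) x.
Proof.
move=> vb; rewrite /riemann sublinZ ?invr_ge0//; last first.
  by apply: bLip_sum => k; exact: bLip_shift.
apply: ler_wpM2l; first by rewrite invr_ge0.
apply: le_trans (sublin_sum T_sub _ _ _) _ => [k|]; first exact: bLip_shift.
by apply: ler_sum => k _; rewrite sublin_shift.
Qed.

(* Jensen's inequality for the Riemann sums, which approximate the average
   uniformly. *)
Lemma sublin_avg i v x : bLip v -> T (avg eps i v) x <= avg eps i (T v) x.
Proof.
move=> vb; have [K [L vKL]] := bLip_blip vb; have [L0 _ _] := vKL.
have Leps0 : 0 <= L * eps by rewrite mulr_ge0// ltW.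
apply/ler_addgt0Pr => e e0; pose N := Num.bound (2 * (L * eps) / e).
have errN : 2 * (L * eps / N.+1%:R) <= e.
  rewrite mulrA ler_pdivrMr ?ltr0n// [e * _]mulrC -ler_pdivrMr//.
  have /archi_boundP : 0 <= 2 * (L * eps) / e.
    by rewrite divr_ge0 ?mulr_ge0// ltW.
  by move/ltW/le_trans; apply; rewrite ler_nat.
have rb : bLip (riemann eps N.+1 i v).
  by apply/bLipZ/bLip_sum => k; exact: bLip_shift.
have close :
    T (avg eps i v) x <= T (riemann eps N.+1 i v) x + L * eps / N.+1%:R.
  apply: sublin_le_addc => // [|y]; first exact: bLip_avg.
  have := avg_riemann eps_gt0 i y N vKL.
  by rewrite ler_norml lerBlDl => /andP[].
have := avg_riemann eps_gt0 i x N (blip_sublin T_sub vKL).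
have := sublin_riemann N.+1 i x vb; rewrite ler_norml.
by move: (L * eps / _) errN close => err ? ? ? /andP[? _]; lra.
Qed.

Lemma sublin_avgs W v x : bLip v -> T (avgs eps W v) x <= avgs eps W (T v) x.
Proof.
move=> vb; elim: W x => //= i W ih x.
apply: le_trans (sublin_avg _ _ _) _; first exact: bLip_avgs.
apply: avg_mono => //.
  by apply: bLip_sublin => //; exact: bLip_avgs.
by apply: bLip_avgs => //; exact: bLip_sublin.
Qed.

End averages.

(* Krylov's argument: since [S] commutes with translations, the mollified
   iterates of [S] are smooth supersolutions of the scheme of [S], hence up to
   small errors of the scheme of [T]. *)
Lemma iter_le_iter_of_mollified S T eps K L B phi n x :
  sublinear_operator S -> sublinear_operator T -> 0 < eps ->
  blip K L phi ->
  (forall w, blip K L w ->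
     forall y, T (mollify eps w) y <= S (mollify eps w) y + B) ->
  iter n T phi x <= iter n S phi x + n%:R * B
    + 2 * (L * mollify_radius d eps).
Proof.
move=> S_sub T_sub eps0 phiKL TS; set r := L * _.
have iterS k : blip K L (iter k S phi) by exact: blip_iter_sublin.
have mollify_near k y : `|mollify eps (iter k S phi) y - iter k S phi y| <= r.
  exact: mollify_close eps0 (iterS k).
suff super k y :
    iter k T phi y <= mollify eps (iter k S phi) y + (k%:R * B + r).
  apply: le_trans (super n x) _; have := mollify_near n x.
  by rewrite ler_norml => /andP[_]; lra.
elim: k y => [|k ih] y.
  by have := mollify_near 0%N y; rewrite /= ler_norml => /andP[+ _]; lra.
have itTb : bLip (iter k T phi).
  exact: blip_bLip (blip_iter_sublin T_sub k phiKL).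
have itSb : bLip (iter k S phi) := blip_bLip (iterS k).
have mb : bLip (mollify eps (iter k S phi)) by exact: bLip_avgs.
have step := sublin_le_addc T_sub itTb mb ih y.
have := TS _ (iterS k) y; have := sublin_avgs eps0 S_sub avg_directions y itSb.
by rewrite -natr1; move: step => /=; lra.
Qed.

Lemma iter_dist_of_mollified S T eps K L B phi n x :
  sublinear_operator S -> sublinear_operator T -> 0 < eps -> blip K L phi ->
  (forall w, blip K L w -> forall y,
     `|S (mollify eps w) y - T (mollify eps w) y| <= B) ->
  `|iter n S phi x - iter n T phi x| <=
    n%:R * B + 2 * (L * mollify_radius d eps).
Proof.
move=> S_sub T_sub eps0 phiKL ST.
have TS w : blip K L w ->
    forall y, T (mollify eps w) y <= S (mollify eps w) y + B.
  by move=> wKL y; have := ST w wKL y; rewrite ler_norml => /andP[? ?]; lra.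
have {}ST w : blip K L w ->
    forall y, S (mollify eps w) y <= T (mollify eps w) y + B.
  by move=> wKL y; have := ST w wKL y; rewrite ler_norml => /andP[? ?]; lra.
have := iter_le_iter_of_mollified n x S_sub T_sub eps0 phiKL TS.
have := iter_le_iter_of_mollified n x T_sub S_sub eps0 phiKL ST.
by rewrite ler_norml => ? ?; apply/andP; split; lra.
Qed.

End sublinear_operators.

(** * Test functions and majorants *)

Section test_functions.
Context {R : realType} {d : nat}.
Local Notation V := 'rV[R]_d.
Implicit Types (v : V -> R) (x y z : V) (i : 'I_d) (t : R).

Definition clip t : R := Num.max (-2) (Num.min 2 t).

Lemma clip_id t : `|t| <= 2 -> clip t = t.
Proof.
rewrite ler_norml => /andP[t_ge t_le].
by rewrite /clip (min_idPr t_le) (max_idPr t_ge).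
Qed.

Lemma clip_mono s t : s <= t -> clip s <= clip t.
Proof. by move=> st; rewrite /clip le_max2 ?le_min2. Qed.

Lemma norm_clip t : `|clip t| <= 2.
Proof.
rewrite ler_norml /clip le_max lexx/= ge_max ge_min lexx/=.
by rewrite (@le_trans _ _ 0)// lerNl oppr0.
Qed.

Lemma clip_lipschitz s t : `|clip s - clip t| <= `|s - t|.
Proof.
wlog st : s t / s <= t => [hw|].
  by have [/hw//|/ltW/hw] := leP s t; rewrite distrC [leRHS]distrC.
rewrite distrC [leRHS]distrC !ger0_norm ?subr_ge0 ?clip_mono//.
rewrite /clip /Num.max /Num.min.
by case: ifPn; case: ifPn; case: ifPn; case: ifPn; rewrite -?leNgt; lra.
Qed.

Definition clip_coord i y : R := clip (y ord0 i).

Lemma blip_clip_coord i : blip 2 1 (clip_coord i).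
Proof.
split=> // [y|x y]; first exact: norm_clip.
rewrite mul1r (le_trans (clip_lipschitz _ _))//.
by have := ler_norm_entry (x - y) ord0 i; rewrite !mxE.
Qed.

(* Small enough for the averages at a point to see only a ball of radius 1/8. *)
Definition test_scale : R := (8 * (size (@avg_directions d)).+1%:R)^-1.

Lemma test_scale_gt0 : 0 < test_scale.
Proof. by rewrite invr_gt0 mulr_gt0// ltr0n. Qed.
Local Hint Resolve test_scale_gt0 : core.

Definition mollify_incr v y : R :=
  mollify test_scale v y - mollify test_scale v 0.

Lemma mollify_incr0 v : mollify_incr v 0 = 0.
Proof. exact: subrr. Qed.

Lemma mollify_incrN v : bLip v ->
  mollify_incr (fun y => - v y) = fun y => - mollify_incr v y.
Proof.
by move=> vb; rewrite /mollify_incr avgsN//; apply/funext => y; ring.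
Qed.

Lemma Cb3_mollify_incr v : bLip v -> Cb3 (mollify_incr v).
Proof.
move=> vb; pose c := mollify test_scale v 0.
have -> : mollify_incr v = mollify test_scale (fun y => v y - c).
  rewrite avgsB//; last exact: bLip_cst.
  by apply/funext => y; rewrite mollify_cst.
by apply: Cb3_mollify => //; apply: bLipB => //; exact: bLip_cst.
Qed.

Lemma mollify_test_scale_mean v : bLip v ->
  exists2 z, `|z| <= 8^-1 & mollify test_scale v 0 = v z.
Proof.
move=> vb; have [z zr ->] := mollify_mean 0 test_scale_gt0 vb.
rewrite subr0 in zr; exists z => //; apply: le_trans zr _.
rewrite /mollify_radius /test_scale invfM -mulrA ler_piMr//.
by rewrite ler_pdivrMl ?ltr0n// mulr1 ler_nat.
Qed.

Lemma mollify_incrE v y : bLip v ->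
  mollify_incr v y = mollify test_scale (fun z => v (y + z) - v z) 0.
Proof.
by move=> vb; rewrite avgsB ?avgs_shift ?addr0//; exact: bLip_shift.
Qed.

Lemma mollify_incr_mean v y : bLip v ->
  exists2 z, `|z| <= 8^-1 & mollify_incr v y = v (y + z) - v z.
Proof.
move=> vb; rewrite mollify_incrE//.
by apply: mollify_test_scale_mean; apply: bLipB => //; exact: bLip_shift.
Qed.

(* Near 0 the clipped coordinate is linear, so mollification only shifts it by a
   constant; centering it at its average makes the mollified square exactly
   quadratic there. *)
Definition lin_test i : V -> R := mollify_incr (clip_coord i).

Definition clip_centered i y : R :=
  clip_coord i y - mollify test_scale (clip_coord i) 0.

Definition quad_test i : V -> R :=
  mollify_incr (fun y => clip_centered i y ^+ 2).

Lemma bLip_clip_coord i : bLip (clip_coord i).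
Proof. exact: blip_bLip (blip_clip_coord i). Qed.
Local Hint Resolve bLip_clip_coord : core.

Lemma bLip_clip_centered i : bLip (clip_centered i).
Proof. by apply: bLipB => //; exact: bLip_cst. Qed.
Local Hint Resolve bLip_clip_centered : core.

Lemma bLip_clip_centered_sqr i : bLip (fun y => clip_centered i y ^+ 2).
Proof. exact: bLipM. Qed.
Local Hint Resolve bLip_clip_centered_sqr : core.

Lemma norm_lin_test i y : `|lin_test i y| <= 4.
Proof.
rewrite /lin_test; have [z _ ->] := mollify_incr_mean y (bLip_clip_coord i).
apply: le_trans (ler_normB _ _) _; rewrite [4](_ : _ = 2 + 2); last by lra.
by apply: lerD; exact: norm_clip.
Qed.

Lemma lin_test_id i y : `|y ord0 i| <= 1 -> lin_test i y = y ord0 i.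
Proof.
move=> y1; rewrite /lin_test.
have [z z8 ->] := mollify_incr_mean y (bLip_clip_coord i).
have zi := le_trans (ler_norm_entry z ord0 i) z8.
have yz := ler_normD (y ord0 i) (z ord0 i).
by rewrite /clip_coord mxE !clip_id ?addrK//; lra.
Qed.

Lemma quad_test_sqr i y : `|y ord0 i| <= 1 -> quad_test i y = y ord0 i ^+ 2.
Proof.
set t : R := y ord0 i => t1; have cb := bLipZ (2 * t) (bLip_clip_centered i).
have sqrb := bLip_clip_centered_sqr i.
have incrb := bLipB (bLip_shift y sqrb) sqrb.
have centered : mollify test_scale (clip_centered i) 0 = 0.
  by rewrite avgsB ?mollify_cst ?subrr//; exact: bLip_cst.
have -> : quad_test i y =
    mollify test_scale (fun z => clip_centered i (y + z) ^+ 2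
      - clip_centered i z ^+ 2 - 2 * t * clip_centered i z) 0.
  by rewrite avgsB// avgsZ// centered mulr0 subr0 -mollify_incrE.
have [z z8 ->] := mollify_test_scale_mean (bLipB incrb cb).
have zi := le_trans (ler_norm_entry z ord0 i) z8.
have tz : `|t + z ord0 i| <= 2 by apply: le_trans (ler_normD _ _) _; lra.
have z2 : `|z ord0 i| <= 2 by lra.
by rewrite /clip_centered /clip_coord mxE -/t !clip_id//; ring.
Qed.

Lemma quad_test_ge i y : 1 <= `|y ord0 i| -> 1 <= 2 * quad_test i y.
Proof.
move=> y1; rewrite /quad_test.
have [z z8 ->] := mollify_incr_mean y (bLip_clip_centered_sqr i).
rewrite /clip_centered.
have [w w8 ->] := mollify_test_scale_mean (bLip_clip_coord i).
have := le_trans (ler_norm_entry z ord0 i) z8.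
have := le_trans (ler_norm_entry w ord0 i) w8.
rewrite /clip_coord !mxE; move: y1.
move: (y _ _) (z _ _) (w _ _) => a b c a1 c8 b8.
have clip_small t : `|t| <= 8^-1 -> clip t = t.
  by move=> t8; apply: clip_id; lra.
rewrite (clip_small b)// (clip_small c)//.
move: b8 c8; rewrite !ler_norml => /andP[b1 b2] /andP[c1 c2].
have bc : (b - c) ^+ 2 <= 16^-1.
  have : 0 <= (4^-1 - (b - c)) * (4^-1 + (b - c)) by apply: mulr_ge0; lra.
  by lra.
suff : 3 / 4 <= `|clip (a + b) - c|.
  move=> n34; have : (3 / 4) ^+ 2 <= `|clip (a + b) - c| ^+ 2.
    by rewrite lerXn2r// nnegrE; lra.
  by rewrite real_normK ?num_real//; lra.
have n78 : `|7 / 8 : R| <= 2 by rewrite ger0_norm; lra.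
rewrite ler_normr; apply/orP; move: a1; rewrite ler_normr => /orP[a1|a1].
  have : clip (7 / 8) <= clip (a + b) by apply: clip_mono; lra.
  by rewrite (clip_id n78); left; lra.
have : clip (a + b) <= clip (- (7 / 8)) by apply: clip_mono; lra.
by rewrite (@clip_id (- _)) ?normrN//; right; lra.
Qed.

Lemma quad_test_ge0 i y : 0 <= quad_test i y.
Proof.
have [y1|/ltW/quad_test_ge] := leP `|y ord0 i| 1; last by lra.
by rewrite quad_test_sqr// sqr_ge0.
Qed.

Definition quad_sum y : R := \sum_i quad_test i y.

Lemma quad_sum_ge0 y : 0 <= quad_sum y.
Proof. by apply: sumr_ge0 => i _; exact: quad_test_ge0. Qed.

Lemma quad_sum_ge y : Num.min 1 (`|y| ^+ 2) <= 2 * quad_sum y.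
Proof.
have [->|/mx_norm_attained[k [i]]] := eqVneq y 0.
  by rewrite normr0 expr0n/= ge_min mulr_ge0 ?orbT ?quad_sum_ge0.
rewrite (ord1 k) => yE; apply: (@le_trans _ _ (2 * quad_test i y)); last first.
  rewrite ler_pM2l// /quad_sum (bigD1 i)//= lerDl sumr_ge0// => j _.
  exact: quad_test_ge0.
rewrite yE ge_min; have [y1|/ltW y1] := leP `|y ord0 i| 1.
  rewrite quad_test_sqr// real_normK ?num_real// [X in _ || X]ler_peMl ?orbT//.
    exact: sqr_ge0.
  by rewrite ler1n.
by rewrite quad_test_ge.
Qed.

Lemma lin_test0 i : lin_test i 0 = 0.
Proof. exact: mollify_incr0. Qed.

Lemma quad_test0 i : quad_test i 0 = 0.
Proof. exact: mollify_incr0. Qed.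

Lemma Cb3_lin_test i : Cb3 (lin_test i).
Proof. exact: Cb3_mollify_incr. Qed.

Lemma Cb3_lin_testN i : Cb3 (fun y => - lin_test i y).
Proof. by rewrite -mollify_incrN//; apply: Cb3_mollify_incr; exact: bLipN. Qed.

Lemma Cb3_quad_test i : Cb3 (quad_test i).
Proof. exact: Cb3_mollify_incr. Qed.

End test_functions.

Definition majorant_const {R : realType} (d : nat) (K B : R) : R :=
  2 * K + 4 * (d%:R * (2 * K + B)) + 2 * (d%:R * B).

Lemma majorant_const_ge0 {R : realType} (d : nat) (K B : R) :
  0 <= K -> 0 <= B -> 0 <= majorant_const d K B.
Proof. by move=> K0 B0; rewrite !addr_ge0 ?mulr_ge0// addr_ge0 ?mulr_ge0. Qed.

Section C11_majorant.
Context {R : realType} {d : nat}.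
Local Notation V := 'rV[R]_d.
Local Notation "''e_' i" := (delta_mx ord0 i : 'rV[R]_d) : ring_scope.
Implicit Types (f : V -> R) (df : 'I_d -> V -> R) (x y z : V) (i : 'I_d).

Definition C11 (K B : R) f df :=
  [/\ 0 <= B, bLip f, forall y, `|f y| <= K, forall i, has_partial B f i (df i)
    & forall i x y, `|df i x - df i y| <= B * `|x - y|].

Lemma C11_mollify eps K L v : 0 < eps -> blip K L v ->
  C11 K (2 * L / eps) (mollify eps v)
    (fun i => avgs eps (rem i avg_directions) (diffq eps i v)).
Proof.
move=> eps0 vKL; have [_ mK _] := blip_avgs eps0 avg_directions vKL.
have [L0 _ _] := vKL; split=> // [||i|i].
- by rewrite divr_ge0 ?mulr_ge0// ltW.
- exact: bLip_avgs (blip_bLip vKL).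
- by apply: (avgs_has_partial eps0 vKL); exact: mem_avg_directions.
- by have [] := blip_avgs eps0 (rem i avg_directions) (blip_diffq eps0 i vKL).
Qed.

Variables (K B : R) (f : V -> R) (df : 'I_d -> V -> R).
Hypothesis fC11 : C11 K B f df.

Lemma C11_bound_ge0 : 0 <= K.
Proof. by case: fC11 => _ _ fK _ _; exact: le_trans (fK 0). Qed.

Lemma C11_taylor y :
  `|f y - f 0 - \sum_i y ord0 i * df i 0| <= d%:R * (2 * B * `|y| ^+ 2).
Proof.
have [B0 _ _ fB dfB] := fC11; rewrite -{1}[y]add0r.
apply: telescope_coord => i z zy; set t := y ord0 i; rewrite add0r.
have ty : `|t| <= `|y| := ler_norm_entry y ord0 i.
have -> : f (z + t *: 'e_i) - f z - t * df i 0 =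
  (f (z + t *: 'e_i) - f z - t * df i z) + t * (df i z - df i 0) by ring.
have t2y : t ^+ 2 <= `|y| ^+ 2.
  by rewrite -real_normK ?num_real// lerXn2r ?nnegrE.
have remainder := le_trans (fB i z t) (ler_wpM2l B0 t2y).
have slope : `|t * (df i z - df i 0)| <= B * `|y| ^+ 2.
  rewrite normrM expr2 mulrCA; apply: ler_pM => //.
  by apply: le_trans (dfB i z 0) _; rewrite subr0 ler_wpM2l.
by apply: le_trans (ler_normD _ _) _; have := lerD remainder slope; lra.
Qed.

Variable rho : R.
Hypotheses (rho_gt0 : 0 < rho) (rho_le1 : rho <= 1).
Hypothesis f_small : forall y, `|y| <= rho^-1 -> `|f y| <= K * rho ^+ 4.

Let rhoV_ge1 : 1 <= rho^-1. Proof. by rewrite invf_ge1. Qed.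

Let rho2_le1 : rho ^+ 2 <= 1. Proof. by rewrite exprn_ile1// ltW. Qed.

Let ball_0 : `|0 : V| <= rho^-1. Proof. by rewrite normr0 invr_ge0 ltW. Qed.

(* Interpolation between the bound on [f] and the Taylor remainder over steps of
   length [rho ^+ 2]. *)
Lemma C11_gradient_small i : `|df i 0| <= (2 * K + B) * rho ^+ 2.
Proof.
have [_ _ _ fB _] := fC11; have rho2_gt0 : 0 < rho ^+ 2 by exact: exprn_gt0.
have ball_e : `|rho ^+ 2 *: 'e_i| <= rho^-1.
  apply: le_trans (norm_scale_delta_le _ _) _; rewrite (gtr0_norm rho2_gt0).
  exact: le_trans rho2_le1 rhoV_ge1.
rewrite -(ler_pM2l rho2_gt0) -[X in X * `|_|](gtr0_norm rho2_gt0) -normrM.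
rewrite [leRHS](_ : _ = (2 * K + B) * rho ^+ 4); last by ring.
have := fB i 0 (rho ^+ 2); have := f_small ball_e; have := f_small ball_0.
rewrite add0r [(rho ^+ 2) ^+ 2](_ : _ = rho ^+ 4); last by ring.
rewrite !ler_norml => /andP[? ?] /andP[? ?] /andP[? ?].
by apply/andP; split; lra.
Qed.

Definition lin_remainder y : R := f y - f 0 - \sum_i df i 0 * lin_test i y.

Lemma lin_remainder_near y : `|y| <= 1 ->
  lin_remainder y <= majorant_const d K B * `|y| ^+ 2.
Proof.
have K0 := C11_bound_ge0; have [B0 _ _ _ _] := fC11 => y1.
have dB0 : 0 <= d%:R * B by exact: mulr_ge0.
have dK0 : 0 <= d%:R * K by exact: mulr_ge0.
have lin_sum : \sum_i df i 0 * lin_test i y = \sum_i y ord0 i * df i 0.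
  apply: eq_bigr => i _; rewrite lin_test_id 1?mulrC//.
  exact: le_trans (ler_norm_entry y ord0 i) y1.
rewrite /lin_remainder lin_sum.
apply: le_trans (le_trans (ler_norm _) (C11_taylor y)) _.
by rewrite mulrA ler_wpM2r ?sqr_ge0// /majorant_const; lra.
Qed.

Lemma lin_remainder_mid y : `|y| <= rho^-1 ->
  lin_remainder y <= majorant_const d K B * rho ^+ 2.
Proof.
have K0 := C11_bound_ge0; have [B0 _ _ _ _] := fC11 => y_rho.
have f_le z : `|z| <= rho^-1 -> `|f z| <= K * rho ^+ 2.
  move=> /f_small/le_trans; apply.
  by rewrite ler_wpM2l// ler_wiXn2l// ltW.
have : `|\sum_i df i 0 * lin_test i y| <= d%:R * (4 * ((2 * K + B) * rho ^+ 2)).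
  apply: ler_norm_sum_ord_const => i.
  by rewrite normrM mulrC ler_pM ?norm_lin_test ?C11_gradient_small.
have := f_le y y_rho; have := f_le 0 ball_0; rewrite !ler_norml.
move=> /andP[? ?] /andP[? ?] /andP[? ?].
have dBr : 0 <= d%:R * B * rho ^+ 2 by rewrite mulr_ge0 ?sqr_ge0 ?mulr_ge0.
by rewrite /lin_remainder /majorant_const; lra.
Qed.

Lemma lin_remainder_le y : lin_remainder y <= majorant_const d K B.
Proof.
have K0 := C11_bound_ge0; have [B0 _ fK _ _] := fC11.
have D0 : 0 <= 2 * K + B by rewrite addr_ge0 ?mulr_ge0.
have : `|\sum_i df i 0 * lin_test i y| <= d%:R * (4 * (2 * K + B)).
  apply: ler_norm_sum_ord_const => i.
  rewrite normrM mulrC ler_pM ?norm_lin_test//.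
  by apply: le_trans (C11_gradient_small i) _; rewrite ler_piMr.
have dB0 : 0 <= d%:R * B by exact: mulr_ge0.
have := fK y; have := fK 0; rewrite /lin_remainder /majorant_const !ler_norml.
by move=> /andP[? ?] /andP[? ?] /andP[? ?]; lra.
Qed.

Lemma lin_remainder_le_quad y : lin_remainder y <=
  2 * majorant_const d K B *
    (rho ^+ 2 * quad_sum (rho^-1 *: y) + quad_sum (rho *: y)).
Proof.
have [B0 _ _ _ _] := fC11; have A0 := majorant_const_ge0 d C11_bound_ge0 B0.
have rho2_gt0 : 0 < rho ^+ 2 by exact: exprn_gt0.
have Q1 := quad_sum_ge0 (rho^-1 *: y); have Q2 := quad_sum_ge0 (rho *: y).
have {}Q1 := mulr_ge0 (ltW rho2_gt0) Q1.
suff [c Xc cQ] : exists2 c, lin_remainder y <= majorant_const d K B * c &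
    c <= 2 * (rho ^+ 2 * quad_sum (rho^-1 *: y) + quad_sum (rho *: y)).
  by apply: le_trans Xc _; rewrite [2 * _]mulrC -mulrA ler_wpM2l.
have := quad_sum_ge (rho *: y); have := quad_sum_ge (rho^-1 *: y).
rewrite !normrZ !gtr0_norm ?invr_gt0//.
have [near|/ltW far] := leP (rho^-1 * `|y|) 1.
- rewrite (min_idPr _); last by rewrite exprn_ile1// mulr_ge0// invr_ge0 ltW.
  rewrite exprMn exprVn -(ler_pM2l rho2_gt0) mulVKf ?gt_eqF// => y2 _.
  exists (`|y| ^+ 2); last by lra.
  apply: lin_remainder_near; apply: le_trans rho_le1.
  by rewrite -[rho]mulr1 -ler_pdivrMl.
rewrite (min_idPl _) ?exprn_ege1// -(ler_pM2l rho2_gt0) mulr1 => rho2.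
have [y_rho _|/ltW y_rho] := leP `|y| rho^-1.
- by exists (rho ^+ 2); [exact: lin_remainder_mid|lra].
- rewrite (min_idPl _); last by rewrite exprn_ege1// -ler_pdivrMl// mulr1.
  by exists 1; [rewrite mulr1 lin_remainder_le|lra].
Qed.

End C11_majorant.

(** * Self-similar schemes *)

Lemma near_right0_exists (R : realType) (P : R -> Prop) :
  (\forall h \near 0^'+, P h) ->
  exists2 h0 : R, 0 < h0 & forall h : R, 0 < h < h0 -> P h.
Proof.
case/nbhs_ballP => r /= r0 rP; exists r => // h /andP[h0 hr]; apply: rP => //.
by rewrite /ball/= sub0r normrN gtr0_norm.
Qed.

Lemma uniform_littleo (R : realType) (I : Type) (f : R -> I -> R) :
  (forall s, exists M, forall i, `|f s i| <= M) ->
  (forall eta, 0 < eta ->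
     \forall s \near 0^'+, forall i, `|f s i| <= eta * s) ->
  exists rho : R -> R, (rho s / s @[s --> 0^'+] --> 0) /\
    forall s i, `|f s i| <= rho s.
Proof.
move=> f_bounded f_small; pose S s := [set `|f s i| | i in [set: I]].
have S_ubound s : has_ubound (S s).
  by have [M fM] := f_bounded s; exists M => _ [i _ <-].
have S_le s i : `|f s i| <= sup (S s) by apply: ub_le_sup => //; exists i.
exists (fun s => sup (S s)); split=> //.
apply/cvgrPdist_le => eta eta0; near=> s.
have s0 : 0 < s by near: s; exact: nbhs_right_gt.
have fs i : `|f s i| <= eta * s by move: i; near: s; exact: f_small.
rewrite sub0r normrN normrM normfV (gtr0_norm s0) ler_pdivrMr//.
have [[r [i iI fi]]|no_index] := pselect (S s !=set0).
  rewrite ger0_norm ?(le_trans (normr_ge0 _) (S_le s i))//.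
  by apply: ge_sup => [|_ [j _ <-]]; [exists r, i|exact: fs].
have -> : S s = set0 by apply/seteqP; split=> // r Sr; case: no_index; exists r.
by rewrite sup0 normr0 mulr_ge0// ltW.
Unshelve. all: by end_near. Qed.

Lemma quantizer (R : realType) (K tau : R) : 0 < tau ->
  exists N (cell : R -> 'I_N.+1) (center : 'I_N.+1 -> R),
    forall t, `|t| <= K -> `|t - center (cell t)| <= tau.
Proof.
move=> tau0; pose index t := Num.truncn ((t + K) / tau).
exists (index K), (fun t => inord (index t)), (fun k => k%:R * tau - K) => t.
rewrite ler_norml => /andP[tK Kt].
have index_le : (index t <= index K)%N.
  by apply: le_truncn; rewrite ler_pM2r ?invr_gt0//; lra.
rewrite inordK//.
have /andP[] : (index t)%:R <= (t + K) / tau < (index t).+1%:R.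
  by apply: truncn_itv; apply: divr_ge0; [lra|exact: ltW].
rewrite -natr1 ler_pdivlMr// ltr_pdivrMr// mulrDl mul1r ler_norml.
by move: (index t) => k ? ?; apply/andP; split; lra.
Qed.

(* Total boundedness of [blip K L] for uniform convergence on balls: the color
   of a function records its values on a grid up to a small error. *)
Lemma blip_finite_coloring (R : realType) (d : nat) (K L r delta : R) :
  0 <= L -> 0 < delta ->
  exists (C : finType) (color : ('rV[R]_d -> R) -> C), forall v w,
    blip K L v -> blip K L w -> color v = color w ->
    forall y, `|y| <= r -> `|v y - w y| <= delta.
Proof.
move=> L0 delta0; pose tau := delta / (2 * L + 2).
have tau0 : 0 < tau by rewrite divr_gt0// ltr_wpDl// mulr_ge0.
have tauE : (2 * L + 2) * tau = delta.
  by rewrite /tau mulrC divfK// gt_eqF// ltr_wpDl// mulr_ge0.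
have [M [arg_cell [arg_center arg_close]]] := quantizer r tau0.
have [N [val_cell [val_center val_close]]] := quantizer K tau0.
pose node (k : {ffun 'I_d -> 'I_M.+1}) : 'rV[R]_d := \row_j arg_center (k j).
exists {ffun {ffun 'I_d -> 'I_M.+1} -> 'I_N.+1}.
exists (fun v => [ffun k => val_cell (v (node k))]).
move=> v w [_ vK vL] [_ wK wL] vw y yr.
pose k := [ffun j => arg_cell (y ord0 j)].
have yk : `|y - node k| <= tau.
  apply: ler_mx_norm => [|i j]; first exact: ltW.
  rewrite (ord1 i) !mxE ffunE arg_close//.
  exact: le_trans (ler_norm_entry y ord0 j) yr.
have vk := val_close _ (vK (node k)); have wk := val_close _ (wK (node k)).
have same_cell : val_cell (v (node k)) = val_cell (w (node k)).
  by have := congr1 (fun f : {ffun _ -> _} => f k) vw; rewrite !ffunE.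
rewrite same_cell in vk.
have vyk := le_trans (vL y (node k)) (ler_wpM2l L0 yk).
have wyk := le_trans (wL y (node k)) (ler_wpM2l L0 yk).
move: vk wk vyk wyk; rewrite -tauE !ler_norml.
by move=> /andP[? ?] /andP[? ?] /andP[? ?] /andP[? ?]; apply/andP; split; lra.
Qed.

Section self_similar_scheme.
Context {R : realType} {d : nat}.
Local Notation V := 'rV[R]_d.
Implicit Types (v w phi : V -> R) (x y z : V) (i : 'I_d).
Implicit Types (h r K L eps eta : R).
Variables (alpha : R) (T : R -> (V -> R) -> V -> R) (G : (V -> R) -> V -> R).

Definition approx_gen h v x : R := h^-1 * (T h v x - v x).

Hypothesis alpha01 : 0 < alpha <= 1.
Hypothesis T_sub : forall h, sublinear_operator (T h).
Hypothesis T_0 : forall v, T 0 v = v.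
Hypothesis T_scale : forall h r v, 0 < h -> 0 < r ->
  T h (fun y => v (r *: y)) 0 = T (h * r `^ alpha) v 0.
Hypothesis T_gen : forall v, Cb3 v -> forall eta, 0 < eta ->
  \forall h \near 0^'+, forall x, `|approx_gen h v x - G v x| <= eta.

Lemma approx_genE h v x : h != 0 -> T h v x - v x = h * approx_gen h v x.
Proof. by move=> h0; rewrite /approx_gen mulVKf. Qed.

Lemma blip_approx_gen h K L v : 0 < h -> blip K L v ->
  blip (h^-1 * (K + K)) (h^-1 * (L + L)) (approx_gen h v).
Proof.
move=> h0 vKL; have := blipZ h^-1 (blipB (blip_sublin (T_sub h) vKL) vKL).
by rewrite gtr0_norm ?invr_gt0.
Qed.

Lemma Cb3_rate v : Cb3 v -> exists C, forall h, 0 < h -> T h v 0 - v 0 <= C * h.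
Proof.
move=> vC; have [K [L vKL]] := bLip_blip (Cb3_bLip vC).
have [h0 h0_gt0 Gh] := near_right0_exists (T_gen vC ltr01).
have K0 := blip_ge0 vKL; have [_ vK _] := vKL.
exists (`|G v 0| + 1 + 2 * K / h0) => h h_gt0.
have K2 : 0 <= 2 * K / h0 by rewrite divr_ge0 ?mulr_ge0// ltW.
have [hh0|h0h] := ltP h h0.
  have hP : 0 < h < h0 by rewrite h_gt0.
  rewrite approx_genE ?gt_eqF// mulrC ler_pM2r//.
  have := Gh h hP 0; rewrite ler_norml => /andP[_].
  by have := ler_norm (G v 0); lra.
have [_ TvK _] := blip_sublin (T_sub h) vKL.
have : 2 * K <= 2 * K / h0 * h.
  by rewrite mulrAC ler_pdivlMr// ler_wpM2l// mulr_ge0.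
have : 0 <= (`|G v 0| + 1) * h by rewrite mulr_ge0 ?addr_ge0// ltW.
have := vK 0; have := TvK 0; rewrite !ler_norml => /andP[? ?] /andP[? ?].
by rewrite mulrDl; lra.
Qed.

Lemma Cb3_uniform_rate (I : finType) (F : I -> V -> R) :
  (forall k, Cb3 (F k)) ->
  exists2 C, 0 <= C & forall k h, 0 < h -> T h (F k) 0 - F k 0 <= C * h.
Proof.
move=> FC; have /choice[C CP] := fun k => Cb3_rate (FC k).
exists (\sum_k `|C k|) => [|k h h0]; first by rewrite sumr_ge0.
apply: le_trans (CP k h h0) _; rewrite ler_pM2r// (le_trans (ler_norm _))//.
by rewrite (bigD1 k)//= lerDl sumr_ge0.
Qed.

Lemma bLip_quad_sum : bLip (@quad_sum R d).
Proof. by apply: bLip_sum => i; exact/Cb3_bLip/Cb3_quad_test. Qed.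

Lemma quad_sum_rate : exists2 C, 0 <= C &
  forall h r, 0 < h -> 0 < r ->
    T h (fun y => quad_sum (r *: y)) 0 <= C * (h * r `^ alpha).
Proof.
have [C C0 CP] := Cb3_uniform_rate (@Cb3_quad_test R d).
exists (d%:R * C) => [|h r h0 r0]; first exact: mulr_ge0.
rewrite T_scale//; set t := h * _.
have t0 : 0 < t by rewrite mulr_gt0// powR_gt0.
apply: le_trans (sublin_sum (T_sub t) _ _ _) _ => [i|].
  exact/Cb3_bLip/Cb3_quad_test.
rewrite -mulrA; apply: ler_sum_ord_const => i.
by have := CP i t t0; rewrite quad_test0 subr0.
Qed.

Lemma lin_sum_rate : exists2 C, 0 <= C & forall h (a : 'I_d -> R) c, 0 < h ->
  (forall i, `|a i| <= c) ->
  T h (fun y => \sum_i a i * lin_test i y) 0 <= C * c * h.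
Proof.
have [C C0 CP] := Cb3_uniform_rate (@Cb3_lin_test R d).
have [C' C'0 C'P] := Cb3_uniform_rate (@Cb3_lin_testN R d).
exists (d%:R * (C + C')) => [|h a c h0 ac]; first by rewrite mulr_ge0 ?addr_ge0.
have lb i : bLip (@lin_test R d i) by exact/Cb3_bLip/Cb3_lin_test.
apply: le_trans (sublin_sum (T_sub h) _ _ _) _ => [i|]; first exact: bLipZ.
rewrite -!mulrA; apply: ler_sum_ord_const => i.
apply: (@le_trans _ _ (`|a i| * ((C + C') * h))).
  have Ch : 0 <= C * h by rewrite mulr_ge0// ltW.
  have C'h : 0 <= C' * h by rewrite mulr_ge0// ltW.
  have := CP i h h0; have := C'P i h h0; rewrite lin_test0 oppr0 !subr0.
  by rewrite mulrDl => TN Tl; apply: sublinZ_le => //; lra.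
rewrite mulrCA ler_wpM2l ?addr_ge0// ler_wpM2r//; exact: ltW.
Qed.

Lemma sqr_le_powR rho : 0 < rho -> rho <= 1 -> rho ^+ 2 <= rho `^ alpha.
Proof.
have /andP[_ alpha1] := alpha01 => rho0 rho1.
rewrite -powR_mulrn ?(ltW rho0)//; apply: ger_powR; first by rewrite rho0.
by rewrite (le_trans alpha1)// ler1n.
Qed.

Lemma sqr_mul_powRV_le rho : 0 < rho -> rho <= 1 ->
  rho ^+ 2 * rho^-1 `^ alpha <= rho `^ alpha.
Proof.
have /andP[_ alpha1] := alpha01 => rho0 rho1.
rewrite -[rho^-1]powR_inv1 ?(ltW rho0)// -powRrM mulN1r.
rewrite -powR_mulrn ?(ltW rho0)// -powRD; last by rewrite (gt_eqF rho0) implybT.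
by apply: ger_powR; [rewrite rho0|lra].
Qed.

Lemma C11_step_le K B f df rho h : 0 < rho -> rho <= 1 -> C11 K B f df ->
  (forall y, `|y| <= rho^-1 -> `|f y| <= K * rho ^+ 4) ->
  T h f 0 - f 0 <= T h (fun y => \sum_i df i 0 * lin_test i y) 0
    + 2 * majorant_const d K B *
        (rho ^+ 2 * T h (fun y => quad_sum (rho^-1 *: y)) 0
         + T h (fun y => quad_sum (rho *: y)) 0).
Proof.
move=> rho0 rho1 fC11 f_small; have [B0 fb _ _ _] := fC11; have Th := T_sub h.
have A0 := majorant_const_ge0 d (C11_bound_ge0 fC11) B0.
have {}A0 := mulr_ge0 (ler0n R 2) A0.
have linb : bLip (fun y : V => \sum_i df i 0 * lin_test i y).
  by apply: bLip_sum => i; apply: bLipZ; exact/Cb3_bLip/Cb3_lin_test.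
have farb : bLip (fun y : V => quad_sum (rho *: y)).
  by apply/bLip_scale/bLip_quad_sum.
have nearb : bLip (fun y : V => quad_sum (rho^-1 *: y)).
  by apply/bLip_scale/bLip_quad_sum.
have rnearb := bLipZ (rho ^+ 2) nearb; have quadb := bLipD rnearb farb.
have majb := bLipZ (2 * majorant_const d K B) quadb.
rewrite -(sublinZ Th)// ?sqr_ge0// lerBlDr.
apply: le_trans (sublin_le_addc Th fb (bLipD linb majb) (c := f 0) _ 0) _.
  move=> y; rewrite -lerBlDr -lerBlDl.
  by have := lin_remainder_le_quad fC11 rho0 rho1 f_small y.
rewrite lerD2r; apply: le_trans (sublinD Th _ linb majb) _.
rewrite lerD2l (sublinZ Th _ quadb)//; apply: ler_wpM2l => //.
exact: (sublinD Th 0 rnearb farb).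
Qed.

(* The three parts of the majorant cost [rho ^+ 2], [rho ^+ (2 - alpha)] and
   [rho ^+ alpha] respectively. *)
Lemma C11_rate K B : 0 <= K -> 0 <= B ->
  exists2 M, 0 <= M & forall f df rho h, 0 < rho -> rho <= 1 -> 0 < h ->
    C11 K B f df -> (forall y, `|y| <= rho^-1 -> `|f y| <= K * rho ^+ 4) ->
    T h f 0 - f 0 <= M * rho `^ alpha * h.
Proof.
move=> K0 B0; have [C C0 lin_rate] := lin_sum_rate.
have [C' C'0 quad_rate] := quad_sum_rate.
pose A := 2 * majorant_const d K B; pose D := 2 * K + B.
have D0 : 0 <= D by rewrite addr_ge0 ?mulr_ge0.
have A0 : 0 <= A by rewrite mulr_ge0// majorant_const_ge0.
have CD0 := mulr_ge0 C0 D0; have C'h0 h : 0 < h -> 0 <= C' * h.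
  by move=> h0; rewrite mulr_ge0// ltW.
exists (C * D + A * (C' + C')) => [|f df rho h rho0 rho1 h0 fC11 f_small].
  by rewrite addr_ge0// mulr_ge0// addr_ge0.
apply: le_trans (C11_step_le h rho0 rho1 fC11 f_small) _.
rewrite [leRHS](_ : _ = C * D * rho `^ alpha * h
    + A * (C' * h * rho `^ alpha + C' * h * rho `^ alpha)); last by ring.
apply: lerD.
  have df_small := C11_gradient_small fC11 rho0 rho1 f_small.
  apply: le_trans (lin_rate h (df^~ 0) _ h0 df_small) _.
  by rewrite mulrA ler_pM2r// ler_wpM2l//; exact: sqr_le_powR.
rewrite ler_wpM2l//; apply: lerD.
  have rhoV0 : 0 < rho^-1 by rewrite invr_gt0.
  apply: le_trans (ler_wpM2l (sqr_ge0 rho) (quad_rate h rho^-1 h0 rhoV0)) _.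
  rewrite [leLHS](_ : _ = C' * h * (rho ^+ 2 * rho^-1 `^ alpha)); last by ring.
  by rewrite ler_wpM2l ?sqr_mul_powRV_le ?C'h0.
by rewrite -mulrA; exact: quad_rate.
Qed.

Lemma mollify_rate K L eps : 0 < eps -> 0 <= K -> 0 <= L ->
  exists2 C, 0 <= C & forall w, blip K L w -> forall h x, 0 < h ->
    T h (mollify eps w) x <= mollify eps w x + C * h.
Proof.
move=> eps0 K0 L0.
have B0 : 0 <= 2 * L / eps by rewrite divr_ge0 ?mulr_ge0// ltW.
have [C C0 CP] := C11_rate K0 B0; exists C => // w wKL h x h0.
have wxC11 := C11_mollify eps0 (blip_shift x wKL).
have [_ _ wxK _ _] := wxC11.
have := CP _ _ 1 h ltr01 (lexx 1) h0 wxC11 _; rewrite powR1 mulr1.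
rewrite avgs_shift sublin_shift// addr0 lerBlDl; apply=> y _.
by rewrite expr1n mulr1; have := wxK y; rewrite avgs_shift.
Qed.

Lemma exists_small_powR M eta : 0 <= M -> 0 < eta ->
  exists rho : R, [/\ 0 < rho, rho <= 1 & M * rho `^ alpha <= eta].
Proof.
have /andP[alpha0 alpha1] := alpha01 => M0 eta0.
have [b [b0 b1 Mb]] := exists_small_factor M0 eta0.
exists (b `^ alpha^-1); split; first exact: powR_gt0.
  by rewrite (le_trans _ b1)// ge1r_powR ?b0// invf_ge1.
by rewrite -powRrM mulVf ?gt_eqF// powRr1// ltW.
Qed.

Lemma mollify_equicontinuous K L eps eta :
  0 < eps -> 0 <= K -> 0 <= L -> 0 < eta ->
  exists delta r : R, 0 < delta /\ forall g, blip K L g ->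
    (forall y, `|y| <= r -> `|g y| <= delta) ->
    forall h, 0 < h -> T h (mollify eps g) 0 - mollify eps g 0 <= eta * h.
Proof.
move=> eps0 K0 L0 eta0; have K1 : 0 < K + 1 by lra.
have B0 : 0 <= 2 * L / eps by rewrite divr_ge0 ?mulr_ge0// ltW.
have [M M0 MP] := C11_rate (ltW K1) B0.
have [rho [rho0 rho1 Mrho]] := exists_small_powR M0 eta0.
exists ((K + 1) * rho ^+ 4), (rho^-1 + mollify_radius d eps).
split=> [|g gKL g_small h h0]; first by rewrite mulr_gt0 ?exprn_gt0.
have gK1 : blip (K + 1) L g.
  by have [? gK ?] := gKL; split=> // y; rewrite (le_trans (gK y))// lerDl.
have gC11 := C11_mollify eps0 gK1.
apply: le_trans (MP _ _ rho h rho0 rho1 h0 gC11 _) _ => [y y_rho|].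
  have [z zy ->] := mollify_mean y eps0 (blip_bLip gKL).
  apply: g_small; rewrite -[z](subrK y) addrC.
  by apply: le_trans (ler_normD _ _) _; exact: lerD.
by rewrite ler_pM2r.
Qed.

Lemma approx_gen_mollify_equicontinuous K L eps eta :
  0 < eps -> 0 <= K -> 0 <= L -> 0 < eta ->
  exists delta r : R, 0 < delta /\ forall v w, blip K L v -> blip K L w ->
    (forall y, `|y| <= r -> `|v y - w y| <= delta) ->
    forall h, 0 < h ->
      approx_gen h (mollify eps v) 0 <= approx_gen h (mollify eps w) 0 + eta.
Proof.
move=> eps0 K0 L0 eta0; have [delta [r [delta0 equi]]] :=
  mollify_equicontinuous eps0 (addr_ge0 K0 K0) (addr_ge0 L0 L0) eta0.
exists delta, r; split=> // v w vKL wKL vw h h0.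
have vb := blip_bLip vKL; have wb := blip_bLip wKL.
have mB := sublinB (T_sub h) 0 (bLip_avgs eps0 avg_directions vb)
  (bLip_avgs eps0 avg_directions wb).
rewrite -(ler_pM2l h0) mulrDr -!approx_genE ?gt_eqF//.
by have := equi _ (blipB vKL wKL) vw h h0; rewrite avgsB//; move: mB; lra.
Qed.

(* [T_gen] is only pointwise in the test function: a finite coloring and
   equicontinuity make it uniform, a single function of each color controlling
   all the others. *)
Lemma approx_gen_mollify_cauchy K L eps eta :
  0 < eps -> 0 <= K -> 0 <= L -> 0 < eta ->
  exists2 k, 0 < k & \forall h \near 0^'+, forall w, blip K L w -> forall x,
    `|approx_gen h (mollify eps w) x - approx_gen k (mollify eps w) x| <= eta.
Proof.
move=> eps0 K0 L0 eta0; have eta4 : 0 < eta / 4 by rewrite divr_gt0.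
have [delta [r [delta0 equi]]] :=
  approx_gen_mollify_equicontinuous eps0 K0 L0 eta4.
have [C [color color_close]] := @blip_finite_coloring R d K L r delta L0 delta0.
have gen_close v w h : blip K L v -> blip K L w -> color v = color w -> 0 < h ->
    approx_gen h (mollify eps v) 0 <= approx_gen h (mollify eps w) 0 + eta / 4.
  by move=> vKL wKL /(color_close _ _ vKL wKL) vw; exact: equi.
have /choice[g gP] c : exists g, \forall h \near 0^'+, forall w, blip K L w ->
    color w = c -> `|approx_gen h (mollify eps w) 0 - g| <= eta / 2.
  have [[w0 [w0b <-]]|no_c] :=
      pselect (exists w0, blip K L w0 /\ color w0 = c); last first.
    by exists 0; apply: nearW => h w wb wc; case: no_c; exists w.
  exists (G (mollify eps w0) 0).
  have w0C := Cb3_mollify eps0 (blip_bLip w0b).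
  near=> h => w wb ww0; have h0 : 0 < h by near: h; exact: nbhs_right_gt.
  have : forall x,
      `|approx_gen h (mollify eps w0) x - G (mollify eps w0) x| <= eta / 4.
    by near: h; exact: T_gen.
  move=> /(_ 0); rewrite !ler_norml => /andP[? ?].
  have := gen_close w w0 h wb w0b ww0 h0.
  have := gen_close w0 w h w0b wb (esym ww0) h0.
  by move=> ? ?; apply/andP; split; lra.
have [h0 h0_gt0 gen_g] := near_right0_exists (filter_forall _ gP).
pose k := h0 / 2; have k0 : 0 < k by rewrite divr_gt0.
have kh0 : 0 < k < h0 by rewrite k0/= /k; lra.
exists k => //; near=> h => w wb x; have wxb := blip_shift x wb.
have hh0 : 0 < h < h0.
  by apply/andP; split; near: h; [exact: nbhs_right_gt|exact: nbhs_right_lt].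
have := gen_g h hh0 _ _ wxb erefl; have := gen_g k kh0 _ _ wxb erefl.
rewrite /approx_gen avgs_shift !sublin_shift// !addr0 !ler_norml.
by move=> /andP[? ?] /andP[? ?]; apply/andP; split; lra.
Unshelve. all: by end_near. Qed.

Lemma approx_gen_smooth_approx K L k eta :
  0 <= K -> 0 <= L -> 0 < k -> 0 < eta ->
  exists2 C, 0 <= C & forall v, blip K L v ->
    exists g, [/\ bLip g, forall x, `|g x - approx_gen k v x| <= eta
      & forall h x, 0 < h -> T h g x <= g x + C * h /\
                            T h (fun y => - g y) x <= - g x + C * h].
Proof.
move=> K0 L0 k0 eta0; have kV0 : 0 <= k^-1 by rewrite invr_ge0 ltW.
have K'0 : 0 <= k^-1 * (K + K) by rewrite mulr_ge0 ?addr_ge0.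
have L'0 : 0 <= k^-1 * (L + L) by rewrite mulr_ge0 ?addr_ge0.
have [eps eps0 eps_small] := exists_small_radius d L'0 eta0.
have [C C0 rate] := mollify_rate eps0 K'0 L'0; exists C => // v vKL.
have genKL := blip_approx_gen k0 vKL; have genb := blip_bLip genKL.
exists (mollify eps (approx_gen k v)); split=> [|x|h x h0].
- exact: bLip_avgs genb.
- exact: le_trans (mollify_close x eps0 genKL) eps_small.
- split; first exact: rate.
  by have := rate _ (blipN genKL) h x h0; rewrite avgsN.
Qed.

(* A smooth approximation of [approx_gen k v] plays the role of the derivative
   of the iterates at time 0. *)
Lemma iter_approx_gen_expansion (P : set (V -> R)) K L k eta :
  0 <= K -> 0 <= L -> 0 < k -> 0 < eta -> (forall v, P v -> blip K L v) ->
  (\forall h \near 0^'+, forall v, P v ->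
     forall x, `|approx_gen h v x - approx_gen k v x| <= eta) ->
  \forall s \near 0^'+, forall n v x, (0 < n)%N -> P v ->
    `|iter n (T (s / n%:R)) v x - v x - s * approx_gen k v x| <= 4 * eta * s.
Proof.
move=> K0 L0 k0 eta0 PKL /near_right0_exists[h0 h0_gt0 gen_k].
have [C C0 approx] := approx_gen_smooth_approx K0 L0 k0 eta0.
have [s1 [s1_gt0 _ s1_small]] := exists_small_factor C0 eta0.
near=> s => n v x n0 Pv; have s0 : 0 < s by near: s; exact: nbhs_right_gt.
have Cs : C * s <= eta.
  apply: le_trans s1_small; apply: ler_wpM2l => //.
  by apply: ltW; near: s; exact: nbhs_right_lt.
have n0R : 0 < n%:R :> R by rewrite ltr0n.
pose h := s / n%:R; have h_gt0 : 0 < h by rewrite divr_gt0.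
have hh0 : 0 < h < h0.
  rewrite h_gt0; apply: (@le_lt_trans _ _ s); last first.
    by near: s; exact: nbhs_right_lt.
  by rewrite ler_pdivrMr// ler_peMr ?(ltW s0)// ler1n.
have [g [gb g_close g_rate]] := approx v (PKL v Pv).
have v_rate y : `|T h v y - v y - h * g y| <= h * (2 * eta).
  rewrite approx_genE ?gt_eqF// -mulrBr normrM (gtr0_norm h_gt0) ler_pM2l//.
  have := gen_k h hh0 v Pv y; have := g_close y; rewrite !ler_norml.
  by move=> /andP[? ?] /andP[? ?]; apply/andP; split; lra.
have := iter_expansion (T_sub h) (blip_bLip (PKL v Pv)) gb (ltW h_gt0) v_rate
  (fun y => (g_rate h y h_gt0).1) (fun y => (g_rate h y h_gt0).2) n x.
have nh : n%:R * h = s by rewrite mulrC divfK// gt_eqF.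
rewrite [n%:R * (C * _)]mulrCA !nh.
have := ler_wpM2l (ltW s0) Cs; have := ler_wpM2l (ltW s0) (g_close x).
rewrite -[X in X * `|_|](gtr0_norm s0) -normrM !ler_norml.
by move=> /andP[? ?] ? /andP[? ?]; apply/andP; split; lra.
Unshelve. all: by end_near. Qed.

Lemma iter_refinement phi s eta : bLip phi -> 0 < s -> 0 < eta ->
  \forall n \near \oo, forall m x, (0 < m)%N ->
    `|iter (n * m) (T (s / (n * m)%:R)) phi x
      - iter n (T (s / n%:R)) phi x| <= eta.
Proof.
move=> /bLip_blip[K [L phiKL]] s0 eta0.
have K0 := blip_ge0 phiKL; have [L0 _ _] := phiKL.
have eta4 : 0 < eta / 4 by rewrite divr_gt0.
have [eps eps0 eps_small] := exists_small_radius d L0 eta4.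
pose eta1 := eta / (16 * s).
have eta1_gt0 : 0 < eta1 by rewrite divr_gt0// mulr_gt0.
have [k k0 gen_k] := approx_gen_mollify_cauchy eps0 K0 L0 eta1_gt0.
pose P : set (V -> R) := [set mollify eps w | w in blip K L].
have PKL v : P v -> blip K L v by move=> [w wKL <-]; exact: blip_avgs.
have {}gen_k : \forall h \near 0^'+, forall v, P v ->
    forall x, `|approx_gen h v x - approx_gen k v x| <= eta1.
  by apply: filterS gen_k => h gen_h v [w wKL <-]; exact: gen_h.
have /near_right0_exists[t0 t0_gt0 expansion] :=
  iter_approx_gen_expansion K0 L0 k0 eta1_gt0 PKL gen_k.
near=> n => m x m_gt0.
have n0 : (0 < n)%N by near: n; exact: nbhs_infty_gt.
have n0R : 0 < n%:R :> R by rewrite ltr0n.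
pose t := s / n%:R; have tP : 0 < t < t0.
  rewrite divr_gt0//= ltr_pdivrMr// mulrC -ltr_pdivrMr//.
  by near: n; exact: nbhs_infty_gtr.
have T_close w : blip K L w -> forall y,
    `|iter m (T (t / m%:R)) (mollify eps w) y - T t (mollify eps w) y|
      <= 8 * eta1 * t.
  move=> wKL y; have Pw : P (mollify eps w) by exists w.
  have := expansion t tP m _ y m_gt0 Pw; have := expansion t tP 1%N _ y isT Pw.
  rewrite /= divr1 !ler_norml => /andP[? ?] /andP[? ?].
  by apply/andP; split; lra.
have nB : n%:R * (8 * eta1 * t) = eta / 2.
  by rewrite /eta1 /t; field; rewrite !gt_eqF.
have -> : iter (n * m) (T (s / (n * m)%:R)) phi =
    iter n (iter m (T (t / m%:R))) phi.
  by rewrite iterM natrM invfM mulrA.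
have Tm_sub := sublinear_operator_iter m (T_sub (t / m%:R)).
have := iter_dist_of_mollified n x Tm_sub (T_sub t) eps0 phiKL T_close.
move/le_trans; apply.
by rewrite nB; lra.
Unshelve. all: by end_near. Qed.

Lemma cvg_iter phi s x : bLip phi -> 0 <= s ->
  cvgn (fun n => iter n (T (s / n%:R)) phi x).
Proof.
move=> phib; rewrite le_eqVlt => /predU1P[<-|s0].
  rewrite (_ : (fun n => _) = fun=> phi x); first exact: is_cvg_cst.
  by apply/funext; elim=> [//|n ih]; rewrite iterS mul0r T_0 -[RHS]ih mul0r.
set u := (X in cvgn X); apply: cauchy_cvg; apply: cauchy_exP.
move=> eta eta0; have eta3 : 0 < eta / 3 by rewrite divr_gt0.
have [N _ refine] := iter_refinement phib s0 eta3.
exists (u N.+1), N.+1 => // n /= Nn; rewrite /ball/=.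
have := refine N.+1 (leqnSn N) n x (leq_trans (ltn0Sn N) Nn).
have := refine n (ltnW Nn) N.+1 x isT.
rewrite mulnC -/(u _) -/(u _) -/(u _) !ler_norml ltr_norml.
by move=> /andP[? ?] /andP[? ?]; apply/andP; split; lra.
Qed.

Lemma iter_expansion_Cb3 phi eta : Cb3 phi -> 0 < eta ->
  \forall s \near 0^'+, forall n x, (0 < n)%N ->
    `|iter n (T (s / n%:R)) phi x - phi x - s * G phi x| <= eta * s.
Proof.
move=> phiC eta0; have [K [L phiKL]] := bLip_blip (Cb3_bLip phiC).
have eta10 : 0 < eta / 10 by rewrite divr_gt0.
have [h0 h0_gt0 gen_G] := near_right0_exists (T_gen phiC eta10).
pose k := h0 / 2; have k0 : 0 < k by rewrite divr_gt0.
have kP : 0 < k < h0 by rewrite k0/= /k; lra.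
have eta5 : 0 < eta / 5 by rewrite divr_gt0.
have gen_k : \forall h \near 0^'+, forall v, [set phi] v ->
    forall x, `|approx_gen h v x - approx_gen k v x| <= eta / 5.
  near=> h => v -> x; have hP : 0 < h < h0.
    by apply/andP; split; near: h; [exact: nbhs_right_gt|exact: nbhs_right_lt].
  have := gen_G h hP x; have := gen_G k kP x; rewrite !ler_norml.
  by move=> /andP[? ?] /andP[? ?]; apply/andP; split; lra.
have phi_blip v : [set phi] v -> blip K L v by move=> ->.
have [L0 _ _] := phiKL.
have expansion :=
  iter_approx_gen_expansion (blip_ge0 phiKL) L0 k0 eta5 phi_blip gen_k.
near=> s => n x n0; have s0 : 0 < s by near: s; exact: nbhs_right_gt.
have : forall m v y, (0 < m)%N -> [set phi] v ->
    `|iter m (T (s / m%:R)) v y - v y - s * approx_gen k v y|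
      <= 4 * (eta / 5) * s.
  by near: s.
move=> /(_ n phi x n0 erefl); have := ler_wpM2l (ltW s0) (gen_G k kP x).
rewrite -[X in X * `|_|](gtr0_norm s0) -normrM !ler_norml.
by move=> /andP[? ?] /andP[? ?]; apply/andP; split; lra.
Unshelve. all: by end_near. Qed.

Lemma generator_bounded phi : Cb3 phi -> exists M, forall x, `|G phi x| <= M.
Proof.
move=> phiC; have [K [L phiKL]] := bLip_blip (Cb3_bLip phiC).
have [h0 h0_gt0 gen_G] := near_right0_exists (T_gen phiC ltr01).
pose k := h0 / 2; have k0 : 0 < k by rewrite divr_gt0.
have kP : 0 < k < h0 by rewrite k0/= /k; lra.
have [_ genK _] := blip_approx_gen k0 phiKL; exists (k^-1 * (K + K) + 1) => x.
rewrite -[G phi x](subKr (approx_gen k phi x)).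
by apply: le_trans (ler_normB _ _) _; apply: lerD; [exact: genK|exact: gen_G].
Qed.

Lemma iter_littleo phi : Cb3 phi ->
  exists rho : R -> R, (rho s / s @[s --> 0^'+] --> 0) /\
    forall s n x, (0 < n)%N ->
      `|iter n (T (s / n%:R)) phi x - phi x - s * G phi x| <= rho s.
Proof.
move=> phiC; have [K [L phiKL]] := bLip_blip (Cb3_bLip phiC).
have [M GM] := generator_bounded phiC; have [_ phiK _] := phiKL.
pose err s (nx : nat * V) :=
  iter nx.1.+1 (T (s / nx.1.+1%:R)) phi nx.2 - phi nx.2 - s * G phi nx.2.
have [s|eta eta0|rho [rho0 err_rho]] := uniform_littleo (f := err).
- exists (K + K + `|s| * M) => -[n x]; rewrite /err.
  have [_ itK _] := blip_iter_sublin (T_sub (s / n.+1%:R)) n.+1 phiKL.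
  apply: le_trans (ler_normB _ _) _; apply: lerD.
    by apply: le_trans (ler_normB _ _) _; apply: lerD; [exact: itK|exact: phiK].
  by rewrite normrM ler_wpM2l.
- apply: filterS (iter_expansion_Cb3 phiC eta0) => s small [n x].
  exact: small.
- by exists rho; split=> // s [//|n] x _; exact: (err_rho s (n, x)).
Qed.

End self_similar_scheme.

(** * Random walks *)

Section random_walk.
Context {R : realType} {d : nat} {Omega : Type}.
Local Notation V := 'rV[R]_d.
Variables (H : set (Omega -> R)) (E : (Omega -> R) -> R).
Variable Z : nat -> Omega -> V.
Hypotheses (E_sub : sublinear_expectation H E) (Z_iid : iid H E Z).
Implicit Types (v : V -> R) (x : V) (a : R).

Definition walk_step a v x : R := E (fun w => v (x + a *: Z 0%N w)).

Lemma expect_cst c : E (fun=> c) = c.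
Proof. by case: E_sub => _ _ _ _ []. Qed.

Lemma expect_ident i v : bLip v -> E (v \o Z i) = E (v \o Z 0%N).
Proof.
by case: Z_iid => _ [_ [Zid _]] vb; elim: i => // i <-; exact: Zid.
Qed.

Lemma sublinear_operator_walk_step a : sublinear_operator (walk_step a).
Proof.
case: E_sub => _ _ _ _ [mono _ add hom]; case: Z_iid => _ [Z_rand _].
have inH v x : bLip v -> H (fun w => v (x + a *: Z 0%N w)).
  by move=> /(bLip_affine x a); exact: Z_rand.
split=> [v w vb wb vw x|c x|v w x vb wb|c v x vb c0|v z].
- by apply: mono => [||o]; [exact: inH|exact: inH|exact: vw].
- exact: expect_cst.
- by apply: add; exact: inH.
- by apply: hom => //; exact: inH.
- by apply/funext => x; rewrite /walk_step; under eq_fun do rewrite addrA.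
Qed.

Lemma walk_step0 v x : walk_step 0 v x = v x.
Proof.
by rewrite /walk_step; under eq_fun do rewrite scale0r addr0; exact: expect_cst.
Qed.

Lemma walk_step_scale a r v :
  walk_step a (fun y => v (r *: y)) 0 = walk_step (a * r) v 0.
Proof.
rewrite /walk_step; congr E; apply/funext => w.
by rewrite !add0r scalerA mulrC.
Qed.

Lemma bLip_rows_sum m v x a : bLip v ->
  bLip (fun A : 'M[R]_(m, d) => v (x + a *: \sum_i row i A)).
Proof.
move=> /(bLip_affine x a)/bLip_blip[K [L [L0 vK vL]]]; split; first by exists K.
exists (L * m%:R) => A B; apply: le_trans (vL _ _) _.
rewrite -mulrA; apply: ler_wpM2l => //; rewrite -sumrB.
apply: ler_norm_sum_ord_const => i; rewrite -linearB/=.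
by apply: ler_mx_norm => // j k; rewrite mxE; exact: ler_norm_entry.
Qed.

Lemma expect_partial_sum a n v x : bLip v ->
  E (fun w => v (x + a *: partial_sum Z n w)) = iter n (walk_step a) v x.
Proof.
case: n => [|n] vb.
  rewrite -[RHS]expect_cst; congr E; apply/funext => w.
  by rewrite /partial_sum big_ord0 scaler0 addr0.
elim: n v vb => [|n ih] v vb.
  by congr E; apply/funext => w /=; rewrite /partial_sum big_ord1.
have Tvb := bLip_sublin (sublinear_operator_walk_step a) vb.
rewrite iterSr -ih//.
pose phi (A : 'M[R]_(n.+1 + 1, d)) := v (x + a *: \sum_i row i A).
have phiE w w' : phi (col_mx (first_rows Z n.+1 w) (Z n.+1 w')) =
    v (x + a *: partial_sum Z n.+1 w + a *: Z n.+1 w').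
  rewrite /phi big_split_ord/= big_ord1 rowKd -addrA -scalerDr.
  congr (v (x + a *: (_ + _))); last by apply/rowP => j; rewrite mxE.
  by apply: eq_bigr => i _; rewrite rowKu; apply/rowP => j; rewrite !mxE.
transitivity (E (fun w => phi (col_mx (first_rows Z n.+1 w) (Z n.+1 w)))).
  congr E; apply/funext => w; rewrite phiE /partial_sum big_ord_recr/=.
  by rewrite scalerDr addrA.
have [_ [_ [_ Z_indep]]] := Z_iid.
rewrite (Z_indep n phi (bLip_rows_sum _ x a vb)); congr E; apply/funext => w.
under eq_fun do rewrite phiE.
exact: (expect_ident n.+1 (bLip_affine _ a vb)).
Qed.

End random_walk.

Section walk_scheme.
Context {R : realType} {d : nat} {Omega : Type}.
Local Notation V := 'rV[R]_d.
Variables (alpha : R) (H : set (Omega -> R)) (E : (Omega -> R) -> R).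
Variables (Z : nat -> Omega -> V) (G : (V -> R) -> V -> R).
Hypothesis alpha01 : 0 < alpha <= 1.
Hypotheses (E_sub : sublinear_expectation H E) (Z_iid : iid H E Z).

Definition walk_scheme (h : R) := walk_step E Z (h `^ alpha^-1).

Lemma walk_scheme0 v : walk_scheme 0 v = v.
Proof.
have /andP[alpha0 _] := alpha01; apply/funext => x.
by rewrite /walk_scheme powR0 ?(walk_step0 Z E_sub)// invr_eq0 gt_eqF.
Qed.

Lemma walk_scheme_scale h r v : 0 < h -> 0 < r ->
  walk_scheme h (fun y => v (r *: y)) 0 = walk_scheme (h * r `^ alpha) v 0.
Proof.
have /andP[alpha0 _] := alpha01 => h0 r0; rewrite /walk_scheme walk_step_scale.
by rewrite powRM ?powR_ge0 ?(ltW h0)// -powRrM mulfV ?gt_eqF// powRr1// ltW.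
Qed.

Lemma walk_scheme_approx_gen phi : Cb3 phi ->
  (exists l : R -> R, (l x @[x --> 0^'+] --> 0) /\
    forall s : R, 0 < s <= 1 -> forall x,
      s^-1 * `|E (fun w => phi (x + (s `^ alpha^-1) *: Z 0%N w) - phi x)
               - s * G phi x| <= l s) ->
  forall eta, 0 < eta ->
    \forall h \near 0^'+, forall x,
      `|approx_gen walk_scheme h phi x - G phi x| <= eta.
Proof.
move=> phiC [l [l0 lP]] eta eta0; near=> h => x.
have h0 : 0 < h by near: h; exact: nbhs_right_gt.
have h01 : 0 < h <= 1 by rewrite h0; near: h; exact: nbhs_right_le.
have lh : `|0 - l h| <= eta by near: h; move: eta eta0; exact/cvgrPdist_le.
apply: le_trans (le_trans (lP h h01 x) _); last first.
  by rewrite sub0r normrN in lh; exact: le_trans (ler_norm _) lh.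
have T_sub := sublinear_operator_walk_step E_sub Z_iid (h `^ alpha^-1).
have <- : walk_scheme h phi x - phi x =
    E (fun w => phi (x + (h `^ alpha^-1) *: Z 0%N w) - phi x).
  by rewrite -(sublin_addc T_sub)//; exact: Cb3_bLip.
by rewrite approx_genE ?gt_eqF// -mulrBr normrM (gtr0_norm h0) mulKf ?gt_eqF.
Unshelve. all: by end_near. Qed.

End walk_scheme.

Theorem theorem4p4 (R : realType) (d : nat) (alpha Llo Lhi : R)
    (Omega : Type) (H : set (Omega -> R)) (E : (Omega -> R) -> R)
    (Z : nat -> Omega -> 'rV[R]_d) :
  0 < alpha <= 1 -> 0 < Llo -> 0 < Lhi ->
  sublinear_expectation H E ->
  iid H E Z ->
  (forall i, Eup E (Z i) (@eucl R d) = +oo%E) ->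
  (* (A1) *)
  (exists delta : R, 0 < delta < alpha /\
     exists M : R, forall n : nat, (0 < n)%N ->
       (Eup E (fun w => ((n%:R `^ (- alpha^-1)) *: partial_sum Z n w)%R)
            (fun y => (eucl y `^ delta)%R) <= M%:E)%E) ->
  (* (A2) *)
  (forall phi : 'rV[R]_d -> R, Cb3 phi ->
     exists l : R -> R, (l x @[x --> 0^'+] --> 0) /\
       forall s : R, 0 < s <= 1 -> forall x : 'rV[R]_d,
         s^-1 * `| E (fun w => phi (x + (s `^ alpha^-1) *: Z 0%N w) - phi x)
                   - s * jump_sup alpha Llo Lhi phi x | <= l s) ->
  (* conclusion *)
  forall phi : 'rV[R]_d -> R, Cb3 phi ->
    exists rho : R -> R, (rho s / s @[s --> 0^'+] --> 0) /\
      forall s : R, 0 <= s <= 1 -> forall x : 'rV[R]_d,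
        let A := fun n : nat =>
          `| E (fun w => phi (x + ((s / n%:R) `^ alpha^-1) *: partial_sum Z n w))
             - phi x - s * jump_sup alpha Llo Lhi phi x | in
        cvgn A /\ limn A <= rho s.
Proof.
move=> alpha01 _ _ E_sub Z_iid _ _ A2 phi phiC; have phib := Cb3_bLip phiC.
pose T := walk_scheme alpha E Z; pose G := @jump_sup R alpha Llo Lhi d.
have T_sub h : sublinear_operator (T h) :=
  sublinear_operator_walk_step E_sub Z_iid _.
have T_0 : forall v, T 0 v = v := walk_scheme0 Z alpha01 E_sub.
have T_scale := walk_scheme_scale E Z alpha01.
have T_gen v vC := walk_scheme_approx_gen E_sub Z_iid vC (A2 v vC).
have [rho [rho0 rhoP]] := iter_littleo alpha01 T_sub T_scale T_gen phiC.
exists rho; split=> // s /andP[s0 _] x A.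
pose u n := iter n (T (s / n%:R)) phi x.
have AE : A = fun n => `|u n - phi x - s * G phi x|.
  by apply/funext => n; rewrite /A (expect_partial_sum E_sub Z_iid).
have u_cvg : cvgn u by exact: (cvg_iter alpha01 T_sub T_0 T_scale T_gen).
have A_cvg : cvgn A.
  rewrite AE; apply: is_cvg_norm; apply: is_cvgB; last exact: is_cvg_cst.
  by apply: is_cvgB => //; exact: is_cvg_cst.
split=> //; apply: limr_le => //; near=> n.
by rewrite AE; apply: rhoP; near: n; exact: nbhs_infty_gt.
Unshelve. all: by end_near. Qed.
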